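(* The following conditions are equivalent for a continuum $G$: (i) $G$ is a tame graph; (ii) $G$ is the union of a countable sequence of free arcs and a countable set; (iii) $G$ admits a tame partition; (iv) each point of $G$ but countably many has a neighborhood that is a finite graph.
   Context: Countable means finite or countably infinite. A continuum is a nonempty compact connected metrizable space; a Peano continuum is a locally connected continuum. An arc is a space homeomorphic to $[0,1]$; for an arc $\alpha$, $E(\alpha)$ is the set of its two endpoints and $\alpha^\circ=\alpha\setminus E(\alpha)$ is called its interior. An arc $\alpha$ in a continuum $X$ is a free arc if $\alpha^\circ$ is open in $X$. The order $\operatorname{ord}(x,X)$ of a point $x\in X$ is the least cardinal $\beta$ such that $x$ has a neighborhood base of open sets whose boundaries have cardinality at most $\beta$; $E(X)$ is the set of points of order $1$ (endpoints) and $B(X)$ the set of points of order $\geq 3$ (branchpoints, including those of infinite order). A tame graph is a continuum $G$ such that $E(G)\cup B(G)$ has countable closure. A tame partition of $G$ is a countable family $\mathcal{P}$ of free arcs with pairwise disjoint interiors covering $G$ up to a countable set of points. A finite graph is a Peano continuum which can be written as the union of finitely many arcs any two of which are either disjoint or intersect only in one or both of their endpoints. *)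

(* Defs.v *)
From mathcomp Require Import all_boot all_order all_algebra.
From mathcomp Require Import all_classical all_reals all_analysis.

Set Implicit Arguments.
Unset Strict Implicit.
Unset Printing Implicit Defensive.

Import Order.TTheory GRing.Theory Num.Theory.
Import numFieldNormedType.Exports.

Local Open Scope classical_set_scope.
Local Open Scope card_scope.
Local Open Scope ring_scope.

(* Subspaces of a topological space T are represented by sets A : set T; every
   notion about a set A below refers to the subspace topology of A. *)

Definition homeomorphism (S T : topologicalType) (A : set S) (B : set T)
    (f : S -> T) (g : T -> S) : Prop :=
  [/\ set_bij A B f, {in A, cancel f g},
      {within A, continuous f} & {within B, continuous g}].

(* [within A (nbhs x)] is the neighborhood filter of x in the subspace A. *)
Definition metrizable (R : realType) (T : topologicalType) (A : set T) : Prop :=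
  exists d : T -> T -> R,
    [/\ forall x y, A x -> A y -> 0 <= d x y,
        forall x y, A x -> A y -> (d x y = 0 <-> x = y),
        forall x y, A x -> A y -> d x y = d y x,
        forall x y z, A x -> A y -> A z -> d x z <= d x y + d y z &
        forall x, A x -> forall N : set T,
          within A (nbhs x) N <->
          exists2 e : R, 0 < e & forall y, A y -> d x y < e -> N y].

Definition continuum (R : realType) (T : topologicalType) (A : set T) : Prop :=
  [/\ A !=set0, compact A, connected A & metrizable R A].

Definition locally_connected (T : topologicalType) (A : set T) : Prop :=
  forall x, A x -> forall N : set T, within A (nbhs x) N ->
    exists V : set T,
      [/\ open V, V x, connected (A `&` V) & A `&` V `<=` N].

Definition peano_continuum (R : realType) (T : topologicalType) (A : set T)
    : Prop :=
  continuum R A /\ locally_connected A.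

Definition unit_interval (R : realType) : set R := `[0, 1].

Definition is_arc (R : realType) (T : topologicalType) (A : set T) : Prop :=
  exists (f : R -> T) (g : T -> R), homeomorphism (@unit_interval R) A f g.

(* The set of endpoints does not depend on the parametrization of the arc, so
   that taking the union over all parametrizations is harmless. *)
Definition arc_ends (R : realType) (T : topologicalType) (A : set T) : set T :=
  [set x | exists (f : R -> T) (g : T -> R),
    homeomorphism (@unit_interval R) A f g /\ (x = f 0 \/ x = f 1)].

Definition arc_interior (R : realType) (T : topologicalType) (A : set T)
    : set T :=
  A `\` arc_ends R A.

Definition free_arc (R : realType) (T : topologicalType) (A : set T) : Prop :=
  is_arc R A /\ open (arc_interior R A).

Definition boundary (T : topologicalType) (V : set T) : set T :=
  closure V `\` interior V.

(* Cardinals are represented by sets over arbitrary types, compared with #<=.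
   ord(x, T) is the least cardinal c such that [has_small_base x c], hence
   ord(x, T) >= b means that b is a lower bound of these cardinals c, and
   ord(x, T) = b that b moreover is one of them. *)
Definition has_small_base (T : topologicalType) (x : T) (U : Type) (c : set U)
    : Prop :=
  forall N : set T, nbhs x N ->
    exists V : set T, [/\ open V, V x, V `<=` N & boundary V #<= c].

Definition order_ge (T : topologicalType) (x : T) (U : Type) (b : set U)
    : Prop :=
  forall (W : Type) (c : set W), has_small_base x c -> b #<= c.

Definition order_eq (T : topologicalType) (x : T) (U : Type) (b : set U)
    : Prop :=
  has_small_base x b /\ order_ge x b.

Definition endpoints (T : topologicalType) : set T :=
  [set x | order_eq x `I_1].

Definition branchpoints (T : topologicalType) : set T :=
  [set x | order_ge x `I_3].

Definition tame_graph (R : realType) (G : topologicalType) : Prop :=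
  continuum R [set: G] /\ countable (closure (@endpoints G `|` @branchpoints G)).

Definition tame_partition (R : realType) (G : topologicalType)
    (P : set (set G)) : Prop :=
  [/\ countable P, (forall a, P a -> free_arc R a),
      trivIset P (@arc_interior R G) &
      countable (~` \bigcup_(a in P) a)].

(* The inclusion below also covers the case of disjoint arcs. *)
Definition finite_graph (R : realType) (T : topologicalType) (A : set T)
    : Prop :=
  peano_continuum R A /\
  exists F : set (set T),
    [/\ finite_set F, (forall a, F a -> is_arc R a),
        (forall a b, F a -> F b -> a <> b ->
           a `&` b `<=` arc_ends R a `&` arc_ends R b) &
        A = \bigcup_(a in F) a].

(* Main.v *)
Require Import Defs.
From mathcomp Require Import all_boot all_order all_algebra.
From mathcomp Require Import all_classical all_reals all_analysis.
From mathcomp Require Import lra.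

(** Three of the four implications are soft; the weight of the proof lies in
    finding a free arc around every point x that lies off the closure of the
    endpoints and branchpoints.

    A free arc cover yields a tame partition because the part of the n-th arc
    interior that avoids the previous arcs is, in the parameter of that arc, an
    open subset of the line; its components give countably many subarcs, and
    only endpoints of arcs are lost ([free_arc_cover_partition]). An arc is a
    finite graph, so that a tame partition gives finite graph neighborhoods off
    a countable set. Conversely an interior point of a finite graph N in G which
    is not an end of one of its arcs lies in the interior of a free arc, hence
    is neither an endpoint nor a branchpoint; since compact metrizable spaces
    are hereditarily Lindelof, the points outside the interiors of all free arcs
    form a countable closed set, and it contains the endpoints and branchpoints
    ([locally_finite_graph_tame]).

    Now let x have a neighborhood U of points of order exactly two. Every
    point of U has arbitrarily small neighborhoods W with connected closure and
    exactly two boundary points ([order_two_base]): a clopen piece of the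
    closure of W that missed one of them would bound a neighborhood with at
    most one boundary point. Take such a W around x, with boundary {p, q}, and
    a subcontinuum C of its closure that is irreducible between p and q.
    Irreducibility forces the two boundary points of each small neighborhood of
    a point of C into C ([irreducible_boundary]), and this makes C, off p and q,
    open in the space ([irreducible_open]). If x were off C, then near p there
    would be one exit along C and one along W minus C, so that W could be
    enlarged around p to a neighborhood of x with a single boundary point; hence
    C contains x ([order_two_irreducible]).

    Removing a small neighborhood of a point y cuts C into a part with p and a
    part with q ([irreducible_cut]). Consequently the sets I(y), intersections
    of all subcontinua of C that contain p and y, are linearly ordered by
    inclusion and distinct for distinct y ([initial_part_lt]), and they vary continuously
    with y ([initial_part_near]). Measuring I(y) by its distances to a dense
    sequence turns this order into a continuous injective real function
    ([irreducible_parametrization]), which identifies a neighborhood of x with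
    an interval. As x has order two it is not mapped to an end of this interval
    ([isolates_not_minimum]), and the preimage of a short segment around the
    value at x is the free arc sought ([order_two_free_arc]). *)

Set Implicit Arguments.
Unset Strict Implicit.
Unset Printing Implicit Defensive.

Import Order.TTheory GRing.Theory Num.Theory.
Import numFieldNormedType.Exports.

Local Open Scope classical_set_scope.
Local Open Scope card_scope.
Local Open Scope ring_scope.

(** * Compactness, connectedness and boundaries *)

Section compact_connected.
Context {T : topologicalType}.
Implicit Types (A B C K V W : set T) (P : set T -> Prop).

(** Compactness as an induction principle: the sets whose complement in A has a
    property P that is stable under subsets and unions form a filter, and a
    cluster point of this filter contradicts that P holds locally. It replaces
    finite subcovers below. *)
Lemma compact_ind A P : compact A -> P set0 ->
  (forall B C, B `<=` C -> P C -> P B) ->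
  (forall B C, P B -> P C -> P (B `|` C)) ->
  (forall x, A x -> exists2 N, nbhs x N & P (A `&` N)) -> P A.
Proof.
move=> cA P0 Psub PU Ploc; apply: contrapT => nPA.
pose F : set_system T := [set B | P (A `\` B)].
have FF : ProperFilter F.
  apply: Build_ProperFilter_ex.
    move=> B FB; apply: contrapT => /set0P/negP; rewrite negbK => /eqP B0.
    by apply: nPA; move: FB; rewrite /F /= B0 setD0.
  split.
  - by rewrite /F /= setDT.
  - by move=> B C FB FC; rewrite /F /= setDIr; exact: PU.
  - by move=> B C BC; apply: Psub => x [Ax nCx]; split => // /BC.
have FA : F A by rewrite /F /= setDv.
have [x [Ax /= Fx]] := cA F FF FA.
have [N xN PN] := Ploc x Ax.
have FN : F (~` N) by rewrite /F /= setDE setCK.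
by have [y [/=]] := Fx _ _ FN xN.
Qed.

Lemma connected_sub_closed K A B : connected K -> closed A -> closed B ->
  K `<=` A `|` B -> (forall x, K x -> A x -> B x -> False) ->
  K `&` A !=set0 -> K `<=` A.
Proof.
move=> Kc Ac Bc KAB AB0 K0.
suff -> : K = K `&` A by move=> x [].
apply/esym/Kc => //; last by exists A.
exists (~` B); first exact: closed_openC.
apply/seteqP; split=> x [Kx]; first by move=> Ax; split=> // /(AB0 x Kx Ax).
by move=> nB; split => //; case: (KAB x Kx).
Qed.

(** In a closed set, the two pieces of a separation are closed. *)
Lemma connected_closed_partition K : closed K ->
  (forall A B, closed A -> closed B -> K = A `|` B ->
    (forall x, A x -> B x -> False) -> A !=set0 -> B !=set0 -> False) ->
  connected K.
Proof.
move=> Kc H; apply/connectedP => E [E0 KE [s1 s2]].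
have cl b : closed (E b).
  suff sub : closure (E b) `<=` E b.
    rewrite (_ : E b = closure (E b)); first exact: closed_closure.
    by apply/seteqP; split => //; exact: subset_closure.
  move=> x Ex; have : K x.
    move/closure_id: Kc => ->; apply: closureS Ex => y Ey.
    by rewrite KE; case: b Ey; [right|left].
  rewrite KE; case: b Ex => Ex [] // Ey.
    by have : (E false `&` closure (E true)) x by []; rewrite s2.
  by have : (closure (E false) `&` E true) x by []; rewrite s1.
apply: (H _ _ (cl false) (cl true)) => // x fx tx.
have : (E false `&` closure (E true)) x by split => //; exact: subset_closure.
by rewrite s2.
Qed.

Lemma closure_sub_boundary V : closure V `<=` V `|` boundary V.
Proof.
move=> x Vx; have [Ix|nIx] := pselect (interior V x); last by right.
by left; exact: interior_subset.
Qed.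

Lemma boundary_notin V x : open V -> boundary V x -> ~ V x.
Proof. by move=> oV [_ nVx] Vx; apply: nVx; move/interior_id : oV => ->. Qed.

Lemma boundary_closure V : boundary V `<=` closure V.
Proof. by move=> x []. Qed.

Lemma boundaryP V x : open V -> closure V x -> ~ V x -> boundary V x.
Proof. by move=> oV cVx nVx; split=> // /interior_subset. Qed.

Lemma connected_meets_boundary K V : open V -> connected K ->
  K `&` V !=set0 -> ~ K `<=` V -> K `&` boundary V !=set0.
Proof.
move=> oV Kc KV nKV; apply: contrapT => /set0P/negP; rewrite negbK => /eqP K0.
apply: nKV; suff : K `<=` closure V.
  move=> KcV x Kx; have [//|bx] := closure_sub_boundary (KcV x Kx).
  by have : (K `&` boundary V) x by []; rewrite K0.
apply: (@connected_sub_closed _ _ (~` V)) => //.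
- exact: closed_closure.
- exact: open_closedC.
- move=> x _; have [Vx|] := pselect (V x); last by right.
  by left; exact: subset_closure.
- move=> x Kx cVx nVx; have : (K `&` boundary V) x by split => //; exact: boundaryP.
  by rewrite K0.
- by case: KV => x [Kx Vx]; exists x; split => //; exact: subset_closure.
Qed.

Lemma boundaryU V W : open V -> open W ->
  boundary (V `|` W) `<=` (boundary V `\` W) `|` (boundary W `\` V).
Proof.
move=> oV oW x bx; have nx := boundary_notin (openU oV oW) bx.
have := boundary_closure bx; rewrite closureU => -[cx|cx]; [left|right].
  by split; [apply: boundaryP => // Vx; apply: nx; left|move=> Wx; apply: nx; right].
by split; [apply: boundaryP => // Vx; apply: nx; right|move=> Wx; apply: nx; left].
Qed.

End compact_connected.

Lemma hausdorff_separated {T : topologicalType} (x y : T) :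
  hausdorff_space T -> x <> y ->
  exists U V, [/\ open U, open V, U x, V y & forall z, U z -> V z -> False].
Proof.
rewrite open_hausdorff => hT /eqP /hT [[U V] /= [/set_mem Ux /set_mem Vy]].
move=> [oU oV /eqP UV0]; exists U, V; split => // z Uz Vz.
by have : (U `&` V) z by []; rewrite UV0.
Qed.

Section compact_hausdorff.
Context {T : topologicalType}.
Hypotheses (hT : hausdorff_space T) (cT : compact [set: T]).
Implicit Types A B C K : set T.

Lemma disjoint_closed_separated A B : closed A -> closed B ->
  (forall x, A x -> B x -> False) ->
  exists U1 U2, [/\ open U1, open U2, A `<=` U1, B `<=` U2 &
    forall x, U1 x -> U2 x -> False].
Proof.
move=> Ac Bc AB.
have AnB : set_nbhs A (~` B).
  by apply/set_nbhsP; exists (~` B); split => //; exact: closed_openC.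
have [C /set_nbhsP [V [oV AV VC]] CB] := compact_normal hT cT Ac AnB.
exists V, (~` closure C); split => //.
- exact/closed_openC/closed_closure.
- by move=> x Bx Cx; apply: (CB x).
- by move=> x Vx; apply; apply/subset_closure/VC.
Qed.

(** Zorn's lemma, applied to the parts removed from A. The intersection of a
    chain of continua is connected: neighborhoods of the two pieces of a
    partition of it would, by compactness, already separate a member of the
    chain. *)
Lemma irreducible_continuum A p q : closed A -> connected A -> A p -> A q ->
  exists C, [/\ [/\ C `<=` A, closed C & connected C], C p, C q &
    forall K, K `<=` C -> closed K -> connected K -> K p -> K q -> K = C].
Proof.
move=> Ac Aconn Ap Aq.
pose P B := [/\ closed (A `\` B), connected (A `\` B), ~ B p & ~ B q].
have [F FP Ftot|B [[Bc Bconn Bp Bq] Bmax]] := @Zorn_bigcup _ P; last first.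
  exists (A `\` B); split => //.
  move=> K KC Kc Kconn Kp Kq; apply: contrapT => nKC.
  apply: (Bmax (~` K)).
    split; last first.
      move=> KB; apply: nKC; apply/seteqP; split => // x [Ax nBx].
      by apply: contrapT => nKx; apply/nBx/KB.
    by move=> x Bx /KC [].
  have AK : A `\` ~` K = K.
    by rewrite setDE setCK; apply/setIidPr => x /KC [].
  by split; rewrite ?AK //=; tauto.
have DF : A `\` \bigcup_(X in F) X = A `&` \bigcap_(X in F) (A `\` X).
  apply/seteqP; split=> x [Ax Fx]; split => //.
    by move=> X FX; split => // Xx; apply: Fx; exists X.
  by move=> [X FX Xx]; have [] := Fx X FX.
have Lc : closed (A `\` \bigcup_(X in F) X).
  by rewrite DF; apply: closedI => //; apply: closed_bigI => X /FP [].
split => //; [|by move=> [X /FP [_ _ + _]]|by move=> [X /FP [_ _ _ +]]].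
apply: connected_closed_partition => // K1 K2 K1c K2c KE K12 [x1 K1x] [x2 K2x].
have [U1 [U2 [oU1 oU2 KU1 KU2 U12]]] := disjoint_closed_separated K1c K2c K12.
(* X is a removed part with A minus X inside the union of U1 and U2; the
   value set0 stands for the intersection of the empty chain *)
have [X [FX XO]] : exists X, (F X \/ X = set0) /\ A `\` (U1 `|` U2) `<=` X.
  apply: (@compact_ind _ (A `\` (U1 `|` U2))
    (fun B => exists X, (F X \/ X = set0) /\ B `<=` X)).
  - apply: (subclosed_compact _ cT) => //.
    by apply: closedI => //; apply: open_closedC; exact: openU.
  - by exists set0; split => //; right.
  - by move=> B C BC [X [FX CX]]; exists X; split => //; exact: subset_trans CX.
  - move=> B C [X [FX BX]] [Y [FY CY]].
    have [XY|YX] : X `<=` Y \/ Y `<=` X.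
    + case: FX => [FX|->]; last by left; exact: sub0set.
      case: FY => [FY|->]; last by right; exact: sub0set.
      exact: Ftot.
    + by exists Y; split => // x [/BX /XY|/CY].
    + by exists X; split => // x [/BX|/CY /YX].
  - move=> x [Ax nOx].
    have [X FX Xx] : (\bigcup_(X in F) X) x.
      apply: contrapT => nFx; apply: nOx.
      have : (A `\` \bigcup_(X in F) X) x by [].
      by rewrite KE => -[/KU1|/KU2]; [left|right].
    have [cX _ _ _] := FP X FX.
    exists (~` (A `\` X)).
      by apply: open_nbhs_nbhs; split; [exact: closed_openC|case].
    exists X; split; first by left.
    by move=> y [[Ay _] nAX]; apply: contrapT => nXy; apply: nAX.
have Xconn : connected (A `\` X) by case: FX => [/FP []//|->]; rewrite setD0.
have KX : (K1 `|` K2) `<=` A `\` X.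
  rewrite -KE => x [Ax Fx]; split => // Xx.
  by case: FX => [FX|X0]; [apply: Fx; exists X|move: Xx; rewrite X0].
have : A `\` X `<=` ~` U2.
  apply: (@connected_sub_closed _ _ _ (~` U1)) => //.
  - exact: open_closedC.
  - exact: open_closedC.
  - move=> x _; have [|] := pselect (U1 x); last by right.
    by move=> U1x; left => /(U12 _ U1x).
  - move=> x [Ax nXx] nO2 nO1; apply: nXx; apply: XO; split => //.
    by case.
  - exists x1; split; first by apply: KX; left.
    by move=> U2x; apply: (U12 x1) => //; exact: KU1.
by move=> /(_ x2); apply; [apply: KX; right|exact: KU2].
Qed.

End compact_hausdorff.

(** For a neighborhood N of x, the compact set of points of A off N is mapped
    off f x, hence off a neighborhood of f x; this is the continuity of the
    inverse at f x. *)
Lemma homeomorphism_of_injective (S T : topologicalType) (A : set S)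
    (f : S -> T) : hausdorff_space T -> compact A -> A !=set0 ->
  {within A, continuous f} -> {in A &, injective f} ->
  exists g, homeomorphism A (f @` A) f g.
Proof.
move=> hT cA [x0 Ax0] fc finj.
pose g y := if pselect (exists2 x, A x & f x = y) is left H
  then sval (cid2 H) else x0.
have fK x : A x -> g (f x) = x.
  move=> Ax; rewrite /g; case: pselect => [H|[]]; last by exists x.
  by case: cid2 => z /= Az; apply: finj; exact/mem_set.
exists g; split => //.
- split; first by move=> x Ax; exists x.
    by move=> x y; exact: finj.
  by move=> y [x Ax <-]; exists x.
- by move=> x /set_mem; exact: fK.
- apply/subspace_continuousP => _ [x Ax <-] N; rewrite -[g in nbhs (g _)]/g fK //= => xN.
  have : nbhs (f x) (~` (f @` (A `\` N))).
    apply: (@compact_ind _ A (fun B => nbhs (f x) (~` (f @` (B `\` N))))) => //.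
    + by rewrite set0D image_set0 setC0; exact: filterT.
    + move=> B C BC; apply: filterS; apply: subsetC; apply: image_subset.
      by move=> y [/BC].
    + by move=> B C H1 H2; rewrite setDUl image_setU setCU; exact: filterI.
    + move=> u Au; have [->|ux] := pselect (u = x).
        exists N => //; rewrite (_ : _ `\` _ = set0) ?image_set0 ?setC0.
          exact: filterT.
        by apply/seteqP; split => // y [[]].
      have fux : f u <> f x by move=> fux; apply: ux; apply: finj fux; exact/mem_set.
      have [U1 [U2 [oU1 oU2 U1u U2x U12]]] := hausdorff_separated hT fux.
      exists [set z | A z -> U1 (f z)].
        by move/subspace_continuousP : fc => /(_ u Au U1); apply; exact: open_nbhs_nbhs.
      apply: filterS (open_nbhs_nbhs (conj oU2 U2x)) => y U2y [z [[Az U1z] _]] zy.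
      by apply: (U12 y) => //; rewrite -zy; exact: U1z.
  apply: filterS => y nAN [z Az zy]; rewrite -zy; change (N (g (f z))); rewrite fK //.
  by apply: contrapT => nN; apply: nAN; exists z.
Qed.

(** * Separability of compact metrizable spaces *)

Section metrized.
Context {R : realType} {T : topologicalType} (d : T -> T -> R).

(** A metric for the topology of the whole space, free of the membership
    conditions that relative metrizability carries. *)
Record metrized : Prop := Metrized {
  met_ge0 : forall x y, 0 <= d x y;
  met_xx : forall x, d x x = 0;
  met_sym : forall x y, d x y = d y x;
  met_eq0 : forall x y, d x y = 0 -> x = y;
  met_tri : forall x y z, d x z <= d x y + d y z;
  met_nbhs : forall x N, nbhs x N <->
    exists2 e : R, 0 < e & forall y, d x y < e -> N y }.

Hypothesis dT : metrized.

Lemma nbhs_met x e : 0 < e -> nbhs x [set y | d x y < e].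
Proof. by move=> e0; apply/(met_nbhs dT); exists e. Qed.

Lemma metrized_hausdorff : hausdorff_space T.
Proof.
move=> x y xy; apply: contrapT => nxy.
have d0 : 0 < d x y.
  by rewrite lt_neqAle met_ge0 // andbT eq_sym; apply/eqP => /(met_eq0 dT).
have d20 : 0 < d x y / 2 by rewrite divr_gt0.
have [z [/= xz yz]] := xy _ _ (nbhs_met x d20) (nbhs_met y d20).
have := met_tri dT x z y; rewrite (met_sym dT z y) => /le_lt_trans.
by move/(_ _ (ltrD xz yz)); rewrite -splitr ltxx.
Qed.

Hypothesis cT : compact [set: T].

(** Two sequences can be interleaved, so that having a countable e-net is a
    property to which compactness induction applies. *)
Lemma compact_metrized_separable (x0 : T) :
  exists z : nat -> T, forall x e, 0 < e -> exists n, d (z n) x < e.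
Proof.
have net e : 0 < e -> exists u : nat -> T, forall x, exists i, d (u i) x < e.
  move=> e0; suff [u ux] : exists u : nat -> T,
    forall x, [set: T] x -> exists i, d (u i) x < e by exists u => x; exact: ux.
  apply: (@compact_ind _ _ (fun B => exists u : nat -> T,
    forall x, B x -> exists i, d (u i) x < e)) cT _ _ _ _.
  - by exists (fun=> x0).
  - by move=> B C BC [u ux]; exists u => x /BC /ux.
  - move=> B C [u uB] [v vC].
    exists (fun i => if odd i then u i./2 else v i./2) => x [/uB|/vC] [i di].
      by exists (i.*2.+1); rewrite /= odd_double /= uphalf_double.
    by exists i.*2; rewrite odd_double doubleK.
  - move=> x _; exists [set y | d x y < e]; first exact: nbhs_met.
    by exists (fun=> x) => y [_ /= xy]; exists 0%N.
have /choice[u uP] : forall n : nat, exists u : nat -> T,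
    forall x, exists i, d (u i) x < n.+1%:R^-1.
  by move=> n; apply: net; rewrite invr_gt0.
exists (fun k => if choice.unpickle k is Some (n, i) then u n i else x0) => x e e0.
have [i di] := uP (Num.truncn e^-1) x.
exists (choice.pickle (Num.truncn e^-1, i)); rewrite choice.pickleK.
apply: lt_trans di _; rewrite invf_plt ?posrE //.
exact: truncnS_gt.
Qed.

(** The balls of radius 1 / (m + 1) around a dense sequence are a countable
    base; one member of Q is selected for each of them that lies in some. *)
Lemma compact_metrized_lindelof (S : set T) (Q : set (set T)) :
  (forall x, S x -> exists2 A, Q A & nbhs x A) ->
  exists F : set (set T), [/\ countable F, F `<=` Q & S `<=` \bigcup_(A in F) A].
Proof.
move=> SQ; have [[x0 _]|S0] := pselect (exists x, S x); last first.
  exists set0; split => //.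
  by move=> x Sx; exfalso; apply: S0; exists x.
have [z zP] := compact_metrized_separable x0.
pose has (k : nat * nat) A := Q A /\ forall y, d (z k.1) y < k.2.+1%:R^-1 -> A y.
pose sel k := if pselect (exists A, has k A) is left H then sval (cid H) else set0.
have selP k : (exists A, has k A) -> has k (sel k).
  by move=> H; rewrite /sel; case: pselect => // H'; exact: svalP (cid H').
exists (sel @` [set k | exists A, has k A]); split.
- exact: (sub_countable (card_image_le _ _) (countableP _)).
- by move=> _ [k /selP [Qk _] <-].
- move=> x /SQ [A QA /(met_nbhs dT) [e e0 eA]].
  pose m := Num.truncn (e / 2)^-1.
  have em : m.+1%:R^-1 < e / 2.
    by rewrite invf_plt ?posrE ?divr_gt0 //; exact: truncnS_gt.
  have [n xn] : exists n, d (z n) x < m.+1%:R^-1 by apply: zP; rewrite invr_gt0.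
  have H : exists A, has (n, m) A.
    exists A; split => // y /= yn; apply: eA; rewrite (splitr e).
    apply: le_lt_trans (met_tri dT x (z n) y) _; rewrite (met_sym dT x).
    by apply: ltrD; [exact: lt_trans em|exact: lt_trans em].
  exists (sel (n, m)); first by exists (n, m).
  by have [_] := selP _ H; exact.
Qed.

End metrized.

Lemma metrizable_setTP (R : realType) (T : topologicalType) :
  metrizable R [set: T] -> exists d : T -> T -> R, metrized d.
Proof.
move=> [d [d0 deq dsym dtri dnbhs]]; exists d; split.
- by move=> x y; exact: d0.
- by move=> x; exact/(deq x x I I).
- by move=> x y; exact: dsym.
- by move=> x y /(deq x y I I).
- by move=> x y z; exact: dtri.
- move=> x N; have H := dnbhs x I N; split=> [xN|[e e0 eN]].
    have /H [e e0 eN] : within [set: T] (nbhs x) N by apply: filterS xN => y Ny _.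
    by exists e => // y; exact: eN.
  have : within [set: T] (nbhs x) N by apply/H; exists e => // y _; exact: eN.
  by move=> xN; apply: filterS (xN : nbhs x [set y | [set: T] y -> N y]) => y; exact.
Qed.

(** * Arcs and their endpoints *)

Section homeomorphisms.
Context {S T : topologicalType} {A : set S} {B : set T} {f : S -> T} {g : T -> S}.
Hypothesis fg : homeomorphism A B f g.

Lemma homeo_sub x : A x -> B (f x).
Proof. by case: fg => -[+ _ _] _ _ _; exact. Qed.

Lemma homeo_can x : A x -> g (f x) = x.
Proof. by case: fg => _ + _ _ Ax; apply; exact/mem_set. Qed.

Lemma homeo_inv y : B y -> A (g y) /\ f (g y) = y.
Proof.
case: fg => -[_ _ fB] _ _ _ /fB [x Ax <-].
by rewrite homeo_can.
Qed.

Lemma homeo_image : B = f @` A.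
Proof.
apply/seteqP; split=> y; last by move=> [x Ax <-]; exact: homeo_sub.
by move=> /homeo_inv [Agy fgy]; exists (g y).
Qed.

Lemma homeo_inj : {in A &, injective f}.
Proof. by move=> x y /set_mem Ax /set_mem Ay /(congr1 g); rewrite !homeo_can. Qed.

Lemma homeo_continuous x N : A x -> nbhs (f x) N -> nbhs x [set s | A s -> N (f s)].
Proof. by case: fg => _ _ /subspace_continuousP + _ Ax; apply. Qed.

Lemma homeo_continuousV y N : B y -> nbhs (g y) N -> nbhs y [set z | B z -> N (g z)].
Proof. by case: fg => _ _ _ /subspace_continuousP + By; apply. Qed.

(** The image of V is the trace on U of the preimage of V under g. *)
Lemma homeo_open_image (U : set T) (V : set S) : open U -> U `<=` B -> open V ->
  V `<=` A -> f @` V `<=` U -> open (f @` V).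
Proof.
move=> oU UB oV VA fVU; rewrite openE => _ [x Vx <-]; rewrite /interior.
have Ufx : U (f x) by apply: fVU; exists x.
have xV : nbhs (g (f x)) V.
  by rewrite homeo_can; [exact: open_nbhs_nbhs|exact: VA].
have H1 := homeo_continuousV (UB _ Ufx) xV.
apply: filterS2 H1 (open_nbhs_nbhs (conj oU Ufx)) => y /= gyV Uy.
by have [_ fgy] := homeo_inv (UB y Uy); exists (g y) => //; apply/gyV/UB.
Qed.

End homeomorphisms.

Lemma homeo_sym {S T : topologicalType} {A : set S} {B : set T} {f : S -> T}
  {g : T -> S} : homeomorphism A B f g -> homeomorphism B A g f.
Proof.
move=> fg; split; [split| |by case: fg..].
- by move=> y /(homeo_inv fg) [].
- move=> y z /set_mem By /set_mem Bz yz.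
  by rewrite -(homeo_inv fg By).2 yz (homeo_inv fg Bz).2.
- by move=> x Ax; exists (f x); [exact: (homeo_sub fg)|exact: (homeo_can fg)].
- by move=> y /set_mem By; exact: (homeo_inv fg By).2.
Qed.

Section arcs.
Context {R : realType} {T : topologicalType}.
Implicit Types (A : set T) (f : R -> T) (g : T -> R).

(** Removing an end e of [0, 1] leaves a connected set of parameters, hence a
    connected part of the arc; if f' e were an inner point for f, this part
    would be cut by it. *)
Lemma homeo_end A f g f' g' (e : R) :
  homeomorphism (@unit_interval R) A f g -> homeomorphism (@unit_interval R) A f' g' ->
  e = 0 \/ e = 1 -> f' e = f 0 \/ f' e = f 1.
Proof.
move=> fg fg' e01; apply: contrapT => /not_orP [ne0 ne1].
have I0 : @unit_interval R 0 by rewrite /unit_interval /= in_itv /= lexx ler01.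
have I1 : @unit_interval R 1 by rewrite /unit_interval /= in_itv /= lexx ler01.
have Ie : @unit_interval R e by case: e01 => ->.
pose J : set R := @unit_interval R `\ e.
have Jc : connected J.
  apply/connected_intervalP => x y [+ xe] [+ ye] z /andP[xz zy].
  rewrite /J /unit_interval /= !in_itv /= => /andP[x0 x1] /andP[y0 y1]; split.
    by rewrite (le_trans x0 xz) (le_trans zy y1).
  move=> ze; case: e01 => e01.
    by apply: xe; apply/eqP; rewrite eq_le e01 x0 -e01 -ze xz.
  by apply: ye; apply/eqP; rewrite eq_le e01 y1 -e01 -ze zy.
have cgf : {within J, continuous (g \o f')}.
  apply/subspace_continuousP => x [Ix xe] N.
  move=> /(homeo_continuousV fg (homeo_sub fg' Ix)).
  move=> /(homeo_continuous fg' Ix); apply: filterS => s Hs [Is _].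
  by apply: Hs => //; exact: (homeo_sub fg').
have im t : @unit_interval R t -> f t <> f' e -> ((g \o f') @` J) t.
  move=> It fte; have [Ig' fg'K] := homeo_inv fg' (homeo_sub fg It).
  exists (g' (f t)); last by rewrite /= fg'K (homeo_can fg).
  by split => // H; apply: fte; rewrite -fg'K H.
have /connected_intervalP gJ := connected_continuous_connected Jc cgf.
have [Ige fgK] := homeo_inv fg (homeo_sub fg' Ie).
have [|||s [Is se] /= gs] := gJ 0 1 _ _ (g (f' e)).
- by apply: im => // H; exact: ne0.
- by apply: im => // H; exact: ne1.
- by move: Ige; rewrite /unit_interval /= in_itv.
apply: se; apply: (homeo_inj fg'); [exact/mem_set..|].
rewrite -(homeo_inv fg (homeo_sub fg' Is)).2 gs.
by rewrite fgK.
Qed.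

Lemma arc_endsE A f g : homeomorphism (@unit_interval R) A f g ->
  arc_ends R A = [set f 0; f 1].
Proof.
move=> fg; apply/seteqP; split=> x; last by move=> fx; exists f, g.
by move=> [f' [g' [fg' [->|->]]]]; apply: (homeo_end fg fg'); [left|right].
Qed.

Hypothesis hT : hausdorff_space T.

Lemma segment_image_arc f (a b : R) : a < b -> {within `[a, b], continuous f} ->
  {in `[a, b] &, injective f} ->
  exists g, homeomorphism (@unit_interval R) (f @` `[a, b])
    (fun t => f (a + t * (b - a))) g.
Proof.
move=> ab fc finj; have ab0 : 0 < b - a by rewrite subr_gt0.
pose phi (t : R) := a + t * (b - a).
have phiI t : @unit_interval R t -> `[a, b]%classic (phi t).
  rewrite /unit_interval /phi /= !in_itv /= => /andP[t0 t1]; apply/andP; split.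
    by rewrite lerDl mulr_ge0 // ltW.
  by rewrite -lerBrDl ler_piMl // ltW.
have phic : continuous phi.
  move=> t; apply: (@cvgD _ R^o); [exact: cvg_cst|].
  by apply: (@cvgM R); [exact: cvg_id|exact: cvg_cst].
have -> : f @` `[a, b] = (fun t => f (phi t)) @` @unit_interval R.
  apply/seteqP; split=> y; last by move=> [t /phiI It <-]; exists (phi t).
  move=> [s]; rewrite /= in_itv /= => /andP[as_ sb] <-.
  exists ((s - a) / (b - a)); last first.
    by rewrite /phi divfK ?gt_eqF // addrC subrK.
  rewrite /unit_interval /= in_itv /= divr_ge0 ?subr_ge0 //= ?(ltW ab) //.
  by rewrite ler_pdivrMr // mul1r lerD2r.
apply: homeomorphism_of_injective => //.
- exact: segment_compact.
- by exists 0; rewrite /unit_interval /= in_itv /= lexx ler01.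
- apply/subspace_continuousP => t It N Nft.
  have H : nbhs (phi t) [set s | `[a, b]%classic s -> N (f s)].
    by move/subspace_continuousP: fc => /(_ _ (phiI t It) _ Nft).
  have {}H : nbhs t [set s | `[a, b]%classic (phi s) -> N (f (phi s))].
    exact: (phic t _ H).
  by apply: filterS H => s Hs /phiI; exact: Hs.
- move=> s t /set_mem /phiI Is /set_mem /phiI It /finj H.
  have /addrI /mulIf := H Is It; apply.
  by rewrite gt_eqF.
Qed.

Lemma segment_image_arc_interior f (a b : R) : a < b ->
  {within `[a, b], continuous f} -> {in `[a, b] &, injective f} ->
  is_arc R (f @` `[a, b]) /\ arc_interior R (f @` `[a, b]) = f @` `]a, b[.
Proof.
move=> ab fc finj; have [g fg] := segment_image_arc ab fc finj.
have aab : a \in `[a, b] by rewrite in_itv /= lexx ltW.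
have bab : b \in `[a, b] by rewrite in_itv /= lexx ltW.
split; first by exists (fun t => f (a + t * (b - a))), g.
rewrite /arc_interior (arc_endsE fg) mul0r addr0 mul1r addrC subrK.
apply/seteqP; split=> y.
  move=> [[t It <-] /not_orP[/= ta tb]]; exists t => //.
  move: It; rewrite /= !in_itv /= !lt_neqAle => /andP[-> ->]; rewrite !andbT.
  by apply/andP; split; apply/eqP => H; [apply: ta; rewrite H|apply: tb; rewrite H].
move=> [t]; rewrite /= in_itv /= => /andP[at_ tb] <-.
have tab : t \in `[a, b] by rewrite in_itv /= !ltW.
split; first by exists t.
move=> [/finj|/finj] H.
  by have ta := H tab aab; rewrite ta ltxx in at_.
by have tb' := H tab bab; rewrite tb' ltxx in tb.
Qed.

(** A parametrization of a set A by a set I of reals cuts out a free arc along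
    every segment of I whose inner part is sent into an open subset of A. *)
Lemma free_subarc (I : set R) A f g (U : set T) (a b : R) :
  homeomorphism I A f g -> open U -> U `<=` A -> a < b -> `[a, b] `<=` I ->
  f @` `]a, b[ `<=` U ->
  free_arc R (f @` `[a, b]) /\ arc_interior R (f @` `[a, b]) = f @` `]a, b[.
Proof.
move=> fg oU UA ab abI fU.
have [||arc int] := segment_image_arc_interior (f := f) ab.
- by case: fg => _ _ + _; apply: continuous_subspaceW.
- by move=> x y /abI Ix /abI Iy; apply: (homeo_inj fg); exact/mem_set.
split; last by [].
split; rewrite // int; apply: (homeo_open_image fg oU UA) => //.
by move=> x /= xab; apply: abI; exact: subset_itv_oo_cc xab.
Qed.

Lemma arc_compact A : is_arc R A -> compact A.
Proof.
move=> [f [g fg]]; rewrite (homeo_image fg); apply: continuous_compact.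
  by case: fg.
exact: segment_compact.
Qed.

Lemma arc_closed A : is_arc R A -> closed A.
Proof. by move=> /arc_compact; exact: compact_closed. Qed.

(** A small ball of parameters is an interval, and its image is open in A. *)
Lemma arc_locally_connected A : is_arc R A -> locally_connected A.
Proof.
move=> [f [g fg]] x Ax N xN; have [Igx fgx] := homeo_inv fg Ax.
have : nbhs (f (g x)) [set y | A y -> N y] by rewrite fgx.
move=> /(homeo_continuous fg Igx) /nbhs_ballP [e /= e0 eN].
have gc : {within A, continuous g} by case: fg.
have /continuousP /(_ _ (ball_open (g x) e)) := gc.
move=> /open_subspaceP [V oV VA].
have AV y : A y -> V y <-> ball (g x) e (g y).
  move=> Ay; split=> H.
    by have : (V `&` A) y by []; rewrite VA => -[].
  by have [] : (V `&` A) y by rewrite VA.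
have AVE : A `&` V = f @` (@unit_interval R `&` ball (g x) e).
  apply/seteqP; split=> y.
    by move=> [Ay Vy]; have [Igy fgy] := homeo_inv fg Ay; exists (g y) => //; split => //; exact/(AV y).
  move=> [t [It et] <-]; have At := homeo_sub fg It; split => //.
  by apply/AV => //; rewrite (homeo_can fg).
exists V; split => //.
- by apply/AV => //; exact: ballxx.
- rewrite AVE; apply: connected_continuous_connected; last first.
    by case: fg => _ _ + _; apply: continuous_subspaceW => ? [].
  apply/connected_intervalP; rewrite ball_itv => s t [Is es] [It et] z szt.
  by split; [exact: (interval_is_interval Is It)|exact: (interval_is_interval es et)].
- rewrite AVE => _ [t [It et] <-]; apply: eN => //; exact: (homeo_sub fg).
Qed.

End arcs.

Lemma arc_finite_graph (R : realType) (T : topologicalType) (A : set T) :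
  metrizable R [set: T] -> is_arc R A -> finite_graph R A.
Proof.
move=> /metrizable_setTP [d dT] arcA; have [f [g fg]] := arcA; split.
  split; last exact: (arc_locally_connected arcA).
  have I0 : @unit_interval R 0 by rewrite /unit_interval /= in_itv /= lexx ler01.
  split.
  - by exists (f 0); exact: (homeo_sub fg).
  - exact: (arc_compact arcA).
  - rewrite (homeo_image fg); apply: connected_continuous_connected.
      exact: segment_connected.
    by case: fg.
  - exists d; split.
    + by move=> x y _ _; exact: (met_ge0 dT).
    + by move=> x y _ _; split=> [/(met_eq0 dT)//|->]; exact: (met_xx dT).
    + by move=> x y _ _; exact: (met_sym dT).
    + by move=> x y z _ _ _; exact: (met_tri dT).
    + move=> x Ax N; split.
        move=> /(met_nbhs dT) [e e0 eN]; exists e => // y Ay /eN; exact.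
      by move=> [e e0 eN]; apply/(met_nbhs dT); exists e => // y xy Ay; exact: eN.
exists [set A]; split.
- exact: finite_set1.
- by move=> _ ->.
- by move=> _ _ -> -> [].
- by rewrite bigcup_set1.
Qed.

(** * From a cover by free arcs to a tame partition *)

Lemma countable_setU (T : Type) (A B : set T) :
  countable A -> countable B -> countable (A `|` B).
Proof.
move=> cA cB; rewrite -bigcup2inE; apply: bigcup_countable => // -[|[|n]] //=.
Qed.

Lemma open_component_itv (R : realType) (V : set R) (q : rat) :
  open V -> V `<=` `]0, 1[ -> V (ratr q) ->
  let a := inf (bigcup_ointsub V q) in let b := sup (bigcup_ointsub V q) in
  [/\ bigcup_ointsub V q = `]a, b[%classic, a < b, 0 <= a & b <= 1].
Proof.
move=> oV V01 Vq a b; set I := bigcup_ointsub V q.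
have I01 : I `<=` `]0, 1[ by move=> x /bigcup_ointsub_sub /V01.
have Iq : I (ratr q) by exact/set_mem/bigcup_ointsubxx.
have lbI : lbound I 0 by move=> x /I01; rewrite /= in_itv /= => /andP[/ltW].
have ubI : ubound I 1 by move=> x /I01; rewrite /= in_itv /= => /andP[_ /ltW].
have IE : I = `]a, b[%classic.
  have oI : open I by exact: open_bigcup_ointsub.
  have iI : is_interval I by exact: is_interval_bigcup_ointsub.
  have lI : has_lbound I by exists 0.
  have uI : has_ubound I by exists 1.
  move/interior_id : (oI) => {1}<-; rewrite (interval_bounded_interior iI lI uI).
  by apply/seteqP; split => x; rewrite /= in_itv.
split => //.
- by move: Iq; rewrite IE /= in_itv /= => /andP[/lt_trans]; exact.
- by apply: lb_le_inf => //; exists (ratr q).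
- by apply: sup_le_ub => //; exists (ratr q).
Qed.

(** Number the arcs of F. The set W B of the inner points of B that lie on no
    arc of smaller number is open and is parametrized by an open subset V B of
    the unit interval; the partition consists of the subarcs of B along the
    components of V B. A point of an arc is covered by one of them, or is an
    end of an arc, as the first arc that contains it shows. *)
Lemma free_arc_cover_partition (R : realType) (T : topologicalType)
    (F : set (set T)) (C : set T) : hausdorff_space T ->
  countable F -> (forall A, F A -> free_arc R A) -> countable C ->
  [set: T] = (\bigcup_(A in F) A) `|` C ->
  exists P : set (set T), tame_partition R P.
Proof.
move=> hT cF free cC cover.
have [[x0 _]|T0] := pselect (exists x : T, True); last first.
  exists set0; split => //; rewrite (_ : ~` _ = set0) //.
  by apply/seteqP; split => // x; exfalso; apply: T0; exists x.
have [idx idx_inj] := countable_injP _ cF.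
(* al n is the arc number n, and is empty if there is none *)
pose al n := \bigcup_(B in [set B | F B /\ idx B = n]) B.
have alE B : F B -> al (idx B) = B.
  move=> FB; apply/seteqP; split=> x; last by exists B.
  by move=> [B' [FB' /idx_inj H] B'x]; rewrite -H //; exact/mem_set.
have al_closed n : closed (al n).
  have [[B [FB <-]]|nB] := pselect (exists B, F B /\ idx B = n).
    by rewrite alE //; apply: (arc_closed hT (R := R)); case: (free B FB).
  rewrite (_ : al n = set0); first exact: closed0.
  by apply/seteqP; split => // x [B HB _]; apply: nB; exists B.
pose W B := arc_interior R B `\` \bigcup_(i in `I_(idx B)) al i.
have oW B : F B -> open (W B).
  move=> FB; apply: openI; first by case: (free B FB).
  by apply: closed_openC; apply: closed_bigcup => // i _; exact: al_closed.
have WB B : W B `<=` B by move=> x [[]].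
have /choice [p pP] : forall B, exists p : (R -> T) * (T -> R),
    F B -> homeomorphism (@unit_interval R) B p.1 p.2.
  move=> B; have [FB|nFB] := pselect (F B); last by exists (fun=> x0, fun=> 0).
  by have [[f [g fg]] _] := free B FB; exists (f, g).
pose f B := (p B).1; pose g B := (p B).2.
have fg B : F B -> homeomorphism (@unit_interval R) B (f B) (g B) by exact: pP.
pose V B := g B @` W B.
have V01 B : F B -> V B `<=` `]0, 1[.
  move=> FB _ [x Wx <-]; have Bx := WB _ _ Wx.
  have [Ig fgx] := homeo_inv (fg B FB) Bx.
  case: Wx => [[_ +] _]; rewrite (arc_endsE (fg B FB)) => /not_orP[/= x0' x1'].
  move: Ig; rewrite /unit_interval /= !in_itv /= !le_eqVlt.
  move=> /andP[/orP[/eqP g0|->] /orP[/eqP g1|->]] //; exfalso.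
  - by apply: x0'; rewrite g0 fgx.
  - by apply: x0'; rewrite g0 fgx.
  - by apply: x1'; rewrite -g1 fgx.
have oV B : F B -> open (V B).
  move=> FB; apply: (homeo_open_image (U := `]0, 1[%classic) (homeo_sym (fg B FB)) _ _ (oW B FB)).
  - exact: interval_open.
  - by move=> x; exact: subset_itv_oo_cc.
  - exact: WB.
  - exact: V01.
have fV B x : F B -> V B x -> W B (f B x).
  by move=> FB [y Wy <-]; rewrite (homeo_inv (fg B FB) (WB _ _ Wy)).2.
pose comp B q := bigcup_ointsub (V B) q.
(* components are indexed by the rationals that they contain *)
pose piece (k : set T * rat) :=
  f k.1 @` `[inf (comp k.1 k.2), sup (comp k.1 k.2)].
pose D := [set k : set T * rat | F k.1 /\ V k.1 (ratr k.2)].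
have pieceP k : D k -> [/\ comp k.1 k.2 `<=` `[inf (comp k.1 k.2), sup (comp k.1 k.2)],
    free_arc R (piece k) & arc_interior R (piece k) = f k.1 @` comp k.1 k.2].
  case: k => B q [/= FB Vq].
  have [cE ab a0 b1] := open_component_itv (oV B FB) (V01 B FB) Vq.
  have fc : f B @` comp B q `<=` W B.
    by move=> _ [t /bigcup_ointsub_sub Vt <-]; exact: fV.
  have [||free' int] := free_subarc hT (fg B FB) (oW B FB) (WB B) ab.
  - by apply: subset_itvScc => //; rewrite bnd_simp.
  - by rewrite -cE.
  - split => //; last by rewrite int -cE.
    move=> x cx; have : `]inf (comp B q), sup (comp B q)[%classic x by rewrite -cE.
    exact: subset_itv_oo_cc.
have intW k : D k -> arc_interior R (piece k) `<=` W k.1.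
  move=> Dk; have [_ _ ->] := pieceP k Dk; move=> _ [t /bigcup_ointsub_sub Vt <-].
  by apply: fV => //; case: Dk.
exists (piece @` D); split.
- apply: (sub_countable (card_image_le _ _)).
  apply: (sub_countable (subset_card_le _) (countableX cF (countableP [set: rat]))).
  by move=> [B q] [FB _].
- by move=> _ [k /pieceP [_ ? _] <-].
- move=> _ _ [[B q] Dk <-] [[B' q'] Dk' <-] [x [kx k'x]].
  have Wx := intW _ Dk _ kx; have W'x := intW _ Dk' _ k'x.
  have BB' : B = B'.
    case: Dk Dk' Wx W'x => /= [FB _] [FB' _] [[Bx _] Wx] [[B'x _] W'x].
    have [lt|lt|/idx_inj] := ltngtP (idx B) (idx B').
    - by exfalso; apply: W'x; exists (idx B); rewrite ?alE.
    - by exfalso; apply: Wx; exists (idx B'); rewrite ?alE.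
    - by apply; exact/mem_set.
  subst B'; have [[_ _ E1] [_ _ E2]] := (pieceP _ Dk, pieceP _ Dk').
  move: kx k'x; rewrite E1 E2 /=.
  have FB : F B by case: Dk.
  move=> [s cs sx] [t ct tx].
  have I01 r q0 : comp B q0 r -> r \in @unit_interval R.
    move=> /bigcup_ointsub_sub /(V01 B FB) /= /subset_itv_oo_cc r01.
    by apply/mem_set.
  have st : s = t.
    by apply: (homeo_inj (fg B FB)); [exact: I01 cs|exact: I01 ct|rewrite sx tx].
  have E : comp B q = comp B q'.
    by apply: nondisjoint_bigcup_ointsub; exists s; split => //; rewrite st.
  by rewrite /piece /= E.
- apply: (@sub_countable _ _ _ (C `|` \bigcup_(B in F) arc_ends R B)); last first.
    apply: countable_setU => //; apply: bigcup_countable => // B FB.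
    rewrite (arc_endsE (fg B FB)).
    by apply: finite_set_countable; exact: finite_set2.
  apply: subset_card_le => x nPx.
  have : [set: T] x by []; rewrite cover => -[[B FB Bx]|]; last by left.
  right; move: {2}(idx B) (erefl (idx B)) => n.
  elim/ltn_ind: n B FB Bx => n IH B FB Bx idxB.
  have [ex|nex] := pselect (arc_ends R B x); first by exists B.
  have [[i lti [B' [FB' idxB'] B'x]]|nal] := pselect ((\bigcup_(i in `I_(idx B)) al i) x).
    by apply: (IH i _ B') => //; rewrite -idxB.
  exfalso; apply: nPx.
  have Wx : W B x by [].
  have Vg : V B (g B x) by exists x.
  have := Vg; rewrite {1}(open_bigcup_rat (oV B FB)) => -[q /set_mem Vq cq].
  exists (piece (B, q)); first by exists (B, q).
  have Dk : D (B, q) by [].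
  exists (g B x); last by rewrite /= (homeo_inv (fg B FB) Bx).2.
  by have [+ _ _] := pieceP _ Dk; apply.
Qed.

(** * Orders of points *)

Lemma card_set2_le (T : Type) (p q : T) : [set p; q] #<= `I_2.
Proof.
rewrite (_ : [set p; q] = (fun i => if i is 0%N then p else q) @` `I_2).
  exact: card_image_le.
apply/seteqP; split=> x; first by move=> [->|->]; [exists 0%N|exists 1%N].
by move=> [[|i] _ <-]; [left|right].
Qed.

Lemma card_leI_inj (T : Type) (B : set T) n : B #<= `I_n ->
  exists f : T -> nat, (forall x, B x -> (f x < n)%N) /\
    forall x y, B x -> B y -> f x = f y -> x = y.
Proof.
move=> /pcard_leP[f]; exists f; split; first by have fS := @funS _ _ _ _ f; move=> x /fS.
by have finj := @inj _ _ _ f; move=> x y Bx By; apply: finj; exact/mem_set.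
Qed.

Lemma card_le1P (T : Type) (B : set T) :
  B #<= `I_1 <-> forall x y, B x -> B y -> x = y.
Proof.
split=> [/card_leI_inj [f [f1 finj]] x y Bx By|B1].
  apply: finj => //; have := f1 x Bx; have := f1 y By.
  by rewrite !ltnS !leqn0 => /eqP -> /eqP ->.
have [[x Bx]|B0] := pselect (B !=set0).
  rewrite (_ : B = [set x]); first by rewrite (card_le_eql card_set1).
  by apply/seteqP; split => [y By|y ->//]; exact: B1.
rewrite (_ : B = set0); first exact: card_ge0.
by apply/seteqP; split => // x Bx; apply: B0; exists x.
Qed.

Lemma card_eq2P (T : Type) (B : set T) : B #<= `I_2 -> ~ (B #<= `I_1) ->
  exists p q, p <> q /\ B = [set p; q].
Proof.
move=> /card_leI_inj [f [f2 finj]] /card_le1P nB1.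
have [p [q [Bp Bq pq]]] : exists p q, [/\ B p, B q & p <> q].
  apply: contrapT => H; apply: nB1 => x y Bx By; apply: contrapT => xy.
  by apply: H; exists x, y.
have fI z : B z -> f z = 0%N \/ f z = 1%N.
  by move=> /f2; case: (f z) => [|[|]] //; [left|right].
exists p, q; split => //; apply/seteqP; split=> [z Bz|z [->|->]//].
have npq : f p <> f q by move=> /(finj _ _ Bp Bq).
have [] : f z = f p \/ f z = f q.
- case: (fI p Bp) npq => -> npq; case: (fI q Bq) npq => -> // npq;
    by case: (fI z Bz) => ->; auto.
- by move=> /(finj _ _ Bz Bp); left.
- by move=> /(finj _ _ Bz Bq); right.
Qed.

Lemma card_leIn (T : Type) (B : set T) n : ~ (`I_n.+1 #<= B) -> B #<= `I_n.
Proof.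
move=> nB; have [[m Bm]|/infiniteP natB] := pselect (finite_set B).
  move: nB; rewrite (card_le_eqr Bm) (card_le_eql Bm) !card_le_II.
  by move=> /negP; rewrite -ltnNge ltnS.
by exfalso; apply: nB; apply: card_le_trans natB; exact: card_leT.
Qed.

Lemma has_small_base_le (T : topologicalType) (x : T) (U W : Type) (b : set U)
  (c : set W) : b #<= c -> has_small_base x b -> has_small_base x c.
Proof.
move=> bc xb N /xb [V [oV Vx VN bV]]; exists V; split => //.
exact: card_le_trans bc.
Qed.

(** A point with arbitrarily small neighborhoods without boundary is a
    connected component of its own. *)
Lemma connected_order_ge1 (T : topologicalType) (x y : T) :
  hausdorff_space T -> connected [set: T] -> x <> y -> order_ge x `I_1.
Proof.
move=> hT cT xy W c xc; apply: contrapT => /card_leIn; rewrite II0 => c0.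
have [U1 [U2 [oU1 oU2 U1x U2y U12]]] := hausdorff_separated hT xy.
have [V [oV Vx VU bV]] := xc _ (open_nbhs_nbhs (conj oU1 U1x)).
have /card_le0P bV0 := card_le_trans bV c0.
have [||z [_]] := connected_meets_boundary oV cT; last by rewrite bV0.
- by exists x.
- by move=> /(_ y I) /VU /U12; exact.
Qed.

Section order_two.
Context {R : realType} {T : topologicalType}.
Hypothesis hT : hausdorff_space T.

(** On a nondegenerate continuum these are the points of order exactly two. *)
Definition order_two (x : T) := has_small_base x `I_2 /\ ~ has_small_base x `I_1.

Lemma not_end_not_branch_order_two x y : connected [set: T] -> x <> y ->
  ~ endpoints x -> ~ branchpoints x -> order_two x.
Proof.
move=> cT xy nEx nBx; split.
  have [W [c [xc /card_leIn c2]]] : exists W (c : set W),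
      has_small_base x c /\ ~ (`I_3 #<= c).
    apply: contrapT => H; apply: nBx => W c xc; apply: contrapT => nc.
    by apply: H; exists W, c.
  exact: has_small_base_le c2 xc.
by move=> x1; apply: nEx; split => //; exact: (connected_order_ge1 hT cT xy).
Qed.

Lemma order_two_not_end_branch x : order_two x ->
  ~ endpoints x /\ ~ branchpoints x.
Proof.
move=> [x2 x1]; split; first by case.
by move=> /(_ _ _ x2); rewrite card_le_II.
Qed.

(** A short inner segment of the arc is a neighborhood with two boundary
    points. Conversely each half of the arc is connected and leaves any
    neighborhood of x inside the arc, hence meets its boundary. *)
Lemma free_arc_interior_order_two A x : free_arc R A -> arc_interior R A x ->
  order_two x.
Proof.
move=> [[f [g fg]] oA] Ax.
have arcA : is_arc R A by exists f, g.
have I01 : `]0, 1[%classic `<=` @unit_interval R by exact: subset_itv_oo_cc.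
have intE : arc_interior R A = f @` `]0, 1[.
  have [||] := segment_image_arc_interior hT (f := f) (@ltr01 R).
  - by case: fg.
  - by move=> y z y01 z01; apply: (homeo_inj fg); exact/mem_set.
  - by rewrite -(homeo_image fg).
have small N : nbhs x N -> exists s t u : R,
    [/\ 0 < s, s < u, u < t, t < 1 & f u = x /\ f @` `[s, t] `<=` N].
  move=> xN; have := Ax; rewrite intE => -[u u01 fu]; rewrite -fu in xN.
  have uI : nbhs u `]0, 1[%classic by apply: open_nbhs_nbhs; split => //; exact: interval_open.
  have : nbhs u (`]0, 1[%classic `&` [set s | unit_interval s -> N (f s)]).
    exact: filterI uI (homeo_continuous fg (I01 u u01) xN).
  move=> /nbhs_ballP [e /= e0 eN]; exists (u - e / 2), (u + e / 2), u.
  have e20 : 0 < e / 2 by rewrite divr_gt0.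
  have e2e : e / 2 < e by rewrite ltr_pdivrMr // ltr_pMr // ltr1n.
  have sub z : u - e / 2 <= z <= u + e / 2 -> 0 < z < 1 /\ N (f z).
    move=> /andP[z1 z2]; have : ball u e z.
      rewrite /ball /= distrC ltr_distl; apply/andP; split; lra.
    by move=> /eN [z01 Nz]; split; [move: z01; rewrite /= in_itv|apply/Nz/I01].
  have [/andP[s0 _] _] : 0 < u - e / 2 < 1 /\ N (f (u - e / 2)) by apply: sub; lra.
  have [/andP[_ t1] _] : 0 < u + e / 2 < 1 /\ N (f (u + e / 2)) by apply: sub; lra.
  split => //; [lra|lra|split => //].
  by move=> _ [z] + <-; rewrite /= in_itv /= => /sub [].
have fsub (s t : R) : 0 < s -> t < 1 -> `[s, t] `<=` `]0, 1[%classic.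
  move=> s0 t1 z; rewrite /= !in_itv /= => /andP[sz zt].
  by rewrite (lt_le_trans s0 sz) (le_lt_trans zt t1).
have fI (s t : R) : 0 < s -> t < 1 -> `[s, t] `<=` @unit_interval R.
  by move=> s0 t1 z /(fsub s t s0 t1) /I01.
split=> [N /small [s [t [u [s0 su ut t1 [fu stN]]]]]|x1].
  exists (f @` `]s, t[); split.
  - apply: (homeo_open_image fg oA) => //.
    + by move=> z [].
    + by move=> z /subset_itv_oo_cc; exact: fI.
    + rewrite intE; apply: image_subset => z /subset_itv_oo_cc; exact: fsub.
  - by exists u => //; rewrite /= in_itv /= su.
  - by move=> z [v /subset_itv_oo_cc vst <-]; apply: stN; exists v.
  - apply: card_le_trans (card_set2_le (f s) (f t)); apply: subset_card_le.
    move=> z bz; have : (f @` `[s, t]) z.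
      suff : closed (f @` `[s, t]).
        move=> /closure_id ->; apply: closureS (boundary_closure bz).
        by apply: image_subset; exact: subset_itv_oo_cc.
      apply: compact_closed => //; apply: continuous_compact.
        by case: fg => _ _ + _; apply: continuous_subspaceW; exact: fI.
      exact: segment_compact.
    move=> [v]; rewrite /= in_itv /= => /andP[sv vt] fv.
    have nz : ~ (f @` `]s, t[) z.
      apply: boundary_notin bz; apply: (homeo_open_image fg oA) => //.
      + by move=> z' [].
      + by move=> z' /subset_itv_oo_cc; exact: fI.
      + rewrite intE; apply: image_subset => z' /subset_itv_oo_cc; exact: fsub.
    move: sv vt; rewrite !le_eqVlt => /orP[/eqP sv|sv] /orP[/eqP vt|vt].
    + by left; rewrite -fv sv.
    + by left; rewrite -fv sv.
    + by right; rewrite -fv vt.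
    + by exfalso; apply: nz; exists v => //; rewrite /= in_itv /= sv.
have [V [oV Vx VA /card_le1P bV]] := x1 _ (open_nbhs_nbhs (conj oA Ax)).
have := Ax; rewrite intE => -[u]; rewrite /= in_itv /= => /andP[u0 u1] fu.
have nV (e : R) : e = 0 \/ e = 1 -> ~ V (f e).
  move=> e01 /VA []; rewrite (arc_endsE fg) => _; apply.
  by case: e01 => ->; [left|right].
(* both halves of the arc leave V *)
have half (s t : R) : 0 <= s -> t <= 1 -> s <= u <= t -> s = 0 \/ t = 1 ->
    exists v, [/\ s <= v <= t, v <> u & boundary V (f v)].
  move=> s0 t1 sut st; have stI : `[s, t] `<=` @unit_interval R.
    move=> z; rewrite /unit_interval /= !in_itv /= => /andP[sz zt].
    by rewrite (le_trans s0 sz) (le_trans zt t1).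
  have fc : connected (f @` `[s, t]).
    apply: connected_continuous_connected; first exact: segment_connected.
    by case: fg => _ _ + _; apply: continuous_subspaceW.
  have [||_ [[v vst <-] bfv]] := connected_meets_boundary oV fc.
  - by exists x; split => //; exists u => //; rewrite /= in_itv.
  - have [/andP[su ut]] := sut; case: st => [s_0|t_1] H.
      apply: (nV 0); first by left.
      by apply: H; exists 0 => //; rewrite /= in_itv /= s_0 lexx (le_trans _ ut) // ltW.
    apply: (nV 1); first by right.
    by apply: H; exists 1 => //; rewrite /= in_itv /= t_1 lexx andbT (le_trans su) // ltW.
  exists v; split => //.
  by move=> vu; apply: (boundary_notin oV bfv); rewrite vu fu.
have [||||v [v0u vu bv]] := half 0 u; rewrite ?lexx ?(ltW u0) ?(ltW u1) //; first by left.
have [||||w [wu1 wu bw]] := half u 1; rewrite ?lexx ?(ltW u0) ?(ltW u1) //; first by right.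
have vw : v = w.
  apply: (homeo_inj fg); last exact: bV.
  - apply/mem_set; rewrite /unit_interval /= in_itv /=; lra.
  - apply/mem_set; rewrite /unit_interval /= in_itv /=; lra.
by apply: vu; apply/eqP; rewrite eq_le; subst w; lra.
Qed.

End order_two.

(** * Finite graphs are tame *)

Section finite_graph_to_tame.
Context {R : realType} {T : topologicalType}.
Hypothesis hT : hausdorff_space T.

Definition free_arc_points : set T :=
  \bigcup_(A in [set A | free_arc R A]) arc_interior R A.

Lemma open_free_arc_points : open free_arc_points.
Proof. by apply: bigcup_open => A []. Qed.

(** A point of the interior of N that is an end of no arc of the graph lies on
    a single arc A, and the other arcs are closed; so a neighborhood of it lies
    in A and contains a free subarc. *)
Lemma finite_graph_interior_countable (N : set T) : finite_graph R N ->
  countable (interior N `\` free_arc_points).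
Proof.
move=> [_ [F [finF arcF meetF NF]]].
apply: (@sub_countable _ _ _ (\bigcup_(A in F) arc_ends R A)); last first.
  apply: bigcup_countable; first exact: finite_set_countable.
  move=> A /arcF [f [g fg]]; rewrite (arc_endsE fg).
  exact/finite_set_countable/finite_set2.
apply: subset_card_le => x [Nx nZx]; apply: contrapT => nx; apply: nZx.
have : N x by exact: interior_subset.
rewrite NF => -[A FA Ax]; have arcA := arcF A FA.
pose U := interior N `\` \bigcup_(B in F `\ A) B `\` arc_ends R A.
have oU : open U.
  apply: openI; first apply: openI; first exact: open_interior.
    apply: closed_openC; apply: closed_bigcup; first exact: finite_setD.
    by move=> B [/arcF arcB _]; exact: (arc_closed hT arcB).
  apply: closed_openC; have [f [g fg]] := arcA; rewrite (arc_endsE fg).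
  by apply: compact_closed => //; exact/finite_compact/finite_set2.
have UA : U `<=` A.
  move=> y [[/interior_subset]]; rewrite {1}NF => -[B FB By] nB _.
  by apply: contrapT => nAy; apply: nB; exists B => //; split => // BA; apply: nAy; rewrite -BA.
have Ux : U x.
  split; last by move=> ex; apply: nx; exists A.
  split => // -[B [FB BA] Bx]; apply: nx; exists B => //.
  have AB : A <> B by move=> AB; apply: BA.
  by have [] := meetF A B FA FB AB x (conj Ax Bx).
have [f [g fg]] := arcA; have [Ig fgx] := homeo_inv fg Ax.
have : nbhs (g x) [set s | unit_interval s -> U (f s)].
  by apply: (homeo_continuous fg Ig); rewrite fgx; exact: open_nbhs_nbhs.
have g01 : `]0, 1[%classic (g x).
  have [_] := Ux; rewrite (arc_endsE fg) => /not_orP[/= x0 x1].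
  move: Ig; rewrite /unit_interval /= !in_itv /= !le_eqVlt.
  move=> /andP[/orP[/eqP g0|->] /orP[/eqP g1|->]] //; exfalso.
  - by apply: x0; rewrite g0 fgx.
  - by apply: x0; rewrite g0 fgx.
  - by apply: x1; rewrite -g1 fgx.
have : nbhs (g x) `]0, 1[%classic.
  by apply: open_nbhs_nbhs; split => //; exact: interval_open.
move=> H1 H2; have /nbhs_ballP [e /= e0 eU] : nbhs (g x)
  (`]0, 1[%classic `&` [set s | unit_interval s -> U (f s)]) by exact: filterI.
have e20 : 0 < e / 2 by rewrite divr_gt0.
have e2e : e / 2 < e by rewrite ltr_pdivrMr // ltr_pMr // ltr1n.
have eb z : `[g x - e / 2, g x + e / 2]%classic z -> ball (g x) e z.
  rewrite /= in_itv /= => /andP[z1 z2].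
  by rewrite /ball /= distrC ltr_distl; apply/andP; split; lra.
have ab : g x - e / 2 < g x + e / 2 by lra.
have [||free int] := free_subarc hT fg oU UA ab.
- by move=> z /eb /eU [/subset_itv_oo_cc].
- move=> _ [z zab <-]; have [|z01] := eU z; first exact/eb/subset_itv_oo_cc.
  by apply; exact: subset_itv_oo_cc.
eexists; first exact: free.
by rewrite int; exists (g x) => //; rewrite /= in_itv /=; apply/andP; split; lra.
Qed.

(** The inner points of free arcs form an open set without endpoints and
    branchpoints. What is left is bad, or lies in one of countably many
    interiors of finite graphs, each with countably many remaining points. *)
Lemma locally_finite_graph_tame : compact [set: T] -> metrizable R [set: T] ->
  countable [set x : T | ~ exists N : set T, nbhs x N /\ finite_graph R N] ->
  countable (closure (@endpoints T `|` @branchpoints T)).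
Proof.
move=> cT /metrizable_setTP [d dT] cbad.
set bad := [set x | _] in cbad.
have [F [cF FQ SF]] : exists F : set (set T),
    [/\ countable F, F `<=` [set A | countable (A `\` free_arc_points)] &
      ~` bad `<=` \bigcup_(A in F) A].
  apply: (compact_metrized_lindelof dT cT) => x /contrapT [N [xN gN]].
  exists (interior N); first exact: finite_graph_interior_countable.
  by apply: open_nbhs_nbhs; split => //; exact: open_interior.
apply: (@sub_countable _ _ _
    (bad `|` \bigcup_(A in F) (A `\` free_arc_points))); last first.
  by apply: countable_setU => //; apply: bigcup_countable.
apply: subset_card_le => x clx.
have nZ : ~ free_arc_points x.
  suff : closure (@endpoints T `|` @branchpoints T) `<=` ~` free_arc_points by exact.
  rewrite (_ : ~` free_arc_points = closure (~` free_arc_points)); last first.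
    by apply/closure_id/open_closedC/open_free_arc_points.
  apply: closureS => y + [A freeA Ay].
  have [] := order_two_not_end_branch (free_arc_interior_order_two hT freeA Ay).
  by move=> ? ? [].
have [bx|nbx] := pselect (bad x); [by left|right].
by have [A FA Ax] := SF x nbx; exists A.
Qed.

End finite_graph_to_tame.

(** * Irreducible continua among points of order two *)

Section order_two_structure.
Context {T : topologicalType}.
Hypotheses (hT : hausdorff_space T) (cT : compact [set: T]).
Hypothesis connT : connected [set: T].
Implicit Types (A B C K M N U V W : set T).

(** A neighborhood N of x with this property witnesses that the order of x
    exceeds one. *)
Definition isolates N (x : T) := forall V, open V -> V x -> V `<=` N ->
  ~ (boundary V #<= `I_1).

Definition two_sided W := [/\ open W, connected (closure W) &
  exists r s, r <> s /\ boundary W = [set r; s]].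

Lemma order_two_isolates x : order_two x ->
  exists2 N, open_nbhs x N & isolates N x.
Proof.
move=> [_ x1]; apply: contrapT => H; apply: x1 => N xN.
apply: contrapT => nV; apply: H; exists (interior N).
  by split => //; exact: open_interior.
move=> V oV Vx VN bV; apply: nV; exists V; split => //.
exact: subset_trans VN (@interior_subset _ N).
Qed.

(** If closed sets A and B partition the closure of V and x lies in A, then V
    minus B is a neighborhood of x whose boundary lies in A and in {p, q}; as
    this boundary has two points, A contains p and q. So B is contained in V,
    and is clopen in the whole space. *)
Lemma isolates_connected_closure N x V p q : isolates N x -> open V -> V x ->
  V `<=` N -> boundary V `<=` [set p; q] ->
  [/\ connected (closure V), boundary V p & boundary V q].
Proof.
move=> Nx.
have both V' : open V' -> V' x -> V' `<=` N -> boundary V' `<=` [set p; q] ->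
    boundary V' p /\ boundary V' q.
  move=> oV' V'x V'N bV'; split; apply: contrapT => nb; apply: (Nx _ oV' V'x V'N).
    by apply/card_le1P => y z /[dup] by_ /bV' [yp|->] /[dup] bz /bV' [zp|->] //;
      exfalso; apply: nb; rewrite -?yp -?zp.
  by apply/card_le1P => y z /[dup] by_ /bV' [->|yp] /[dup] bz /bV' [->|zp] //;
    exfalso; apply: nb; rewrite -?yp -?zp.
move=> oV Vx VN bV; have [bp bq] := both V oV Vx VN bV; split => //.
have piece A B : closed A -> closed B -> closure V = A `|` B ->
    (forall y, A y -> B y -> False) -> A x -> B !=set0 -> False.
  move=> Ac Bc VAB AB Ax [b Bb].
  have oV' : open (V `\` B) by apply: openI => //; exact: closed_openC.
  have clV' : closure (V `\` B) `<=` A.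
    rewrite [A](closure_id A).1 //; apply: closureS => y [Vy nBy].
    by have : closure V y; [exact: subset_closure|rewrite VAB => -[]].
  have bV' : boundary (V `\` B) `<=` [set p; q].
    move=> y by_; apply: bV; have Ay := clV' _ (boundary_closure by_).
    apply: boundaryP => //; first by rewrite VAB; left.
    by move=> Vy; apply: (boundary_notin oV' by_); split => // /(AB y Ay).
  have [||b'p b'q] := both _ oV' _ _ bV'.
  - by split => // /(AB x Ax).
  - by move=> y [/VN].
  have BV : B `<=` V.
    move=> y By; have : closure V y by rewrite VAB; right.
    move=> /closure_sub_boundary [//|/bV [yE|yE]]; exfalso; apply: (AB y) => //.
      by rewrite yE; exact: clV' (boundary_closure b'p).
    by rewrite yE; exact: clV' (boundary_closure b'q).
  have BE : B = V `\` A.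
    apply/seteqP; split=> y; first by move=> By; split; [exact: BV|move=> /AB; exact].
    move=> [Vy nAy]; have : closure V y by exact: subset_closure.
    by rewrite VAB => -[].
  have oB : open B by rewrite BE; apply: openI => //; exact: closed_openC.
  have BT : B = [set: T].
    apply: connT; first by exists b.
      by exists B; rewrite ?setTI.
    by exists B; rewrite ?setTI.
  by apply: (AB x Ax); rewrite BT.
apply: connected_closed_partition; first exact: closed_closure.
move=> A B Ac Bc VAB AB A0 B0.
have : closure V x by exact: subset_closure.
rewrite {1}VAB => -[Ax|Bx]; first exact: (piece A B).
apply: (piece B A) => //; first by rewrite setUC.
by move=> y By Ay; exact: (AB y).
Qed.

Lemma order_two_base x N : order_two x -> nbhs x N ->
  exists W, [/\ two_sided W, W x & closure W `<=` N].
Proof.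
move=> x2 xN; have [N0 [oN0 N0x] N0P] := order_two_isolates x2.
have xNN : nbhs x (N `&` N0) by apply: filterI => //; exact: open_nbhs_nbhs.
have [|N1 xN1 N1N] := compact_regular (x := x) hT cT _ xNN; first exact: filterT.
have [W [oW Wx WN1 bW]] := x2.1 _ xN1.
have clW : closure W `<=` N `&` N0 by move=> y /(closureS WN1) /N1N.
have WN0 : W `<=` N0 by move=> y /subset_closure /clW [].
have [r [s [rs bWE]]] := card_eq2P bW (N0P _ oW Wx WN0).
exists W; split => //; last by move=> y /clW [].
split => //; last by exists r, s.
by have [] := isolates_connected_closure N0P oW Wx WN0 (p := r) (q := s);
  rewrite ?bWE.
Qed.

(** C is a continuum that is irreducible between p and q. *)
Definition irreducible C p q := [/\ closed C, connected C, C p, C q &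
  forall K, K `<=` C -> closed K -> connected K -> K p -> K q -> K = C].

(** A piece Q of C minus W that stayed off the boundary of W would be clopen
    in C. *)
Lemma dangling_meets_boundary C W P Q z : connected C -> open W -> C z -> W z ->
  closed P -> closed Q -> C `\` W = P `|` Q -> (forall y, P y -> Q y -> False) ->
  Q !=set0 -> exists2 y, Q y & boundary W y.
Proof.
move=> Cc oW Cz Wz Pc Qc CW PQ [b Qb]; apply: contrapT => nQ.
have CQ y : Q y -> C y /\ ~ W y.
  by move=> Qy; have : (P `|` Q) y; [right|rewrite -CW => -[]].
have : C `<=` Q.
  apply: (@connected_sub_closed _ _ _ (P `|` closure W)) => //.
  - by apply: closedU => //; exact: closed_closure.
  - move=> y Cy; have [Wy|nWy] := pselect (W y).
      by right; right; exact: subset_closure.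
    by have : (C `\` W) y; [|rewrite CW => -[]; [right; left|left]].
  - move=> y Cy Qy [Py|cWy]; first exact: (PQ y).
    by apply: nQ; exists y => //; apply: boundaryP => //; case: (CQ y Qy).
  - by exists b; split => //; case: (CQ b Qb).
by move=> /(_ z Cz) /CQ [_].
Qed.

(** With a single exit from W, the set C minus W would still be connected,
    whereas it contains p and q but not z. *)
Lemma irreducible_boundary C p q W z : irreducible C p q -> open W ->
  C z -> W z -> ~ W p -> ~ W q -> ~ (C `&` boundary W #<= `I_1).
Proof.
move=> [Cc Cconn Cp Cq Cmin] oW Cz Wz nWp nWq /card_le1P b1.
have CWc : closed (C `\` W) by apply: closedI => //; exact: open_closedC.
suff CWconn : connected (C `\` W).
  have E : C `\` W = C by apply: Cmin => // y [].
  by have [] : (C `\` W) z by rewrite E.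
apply: connected_closed_partition => // A B Ac Bc CW AB A0 B0.
have [y By bWy] := dangling_meets_boundary Cconn oW Cz Wz Ac Bc CW AB B0.
have [||u Au bWu] := dangling_meets_boundary Cconn oW Cz Wz Bc Ac _ _ A0.
- by rewrite CW setUC.
- by move=> v Bv Av; exact: (AB v).
apply: (AB u) => //; rewrite (b1 u y) //; split => //.
  by have : (A `|` B) u; [left|rewrite -CW => -[]].
by have : (A `|` B) y; [right|rewrite -CW => -[]].
Qed.

(** C minus W is disconnected by irreducibility. As every piece of it touches
    one of the two boundary points of W, there are exactly two pieces, both
    connected, and p and q lie in different ones, again by irreducibility. *)
Lemma irreducible_cut C p q W z : irreducible C p q -> two_sided W ->
  C z -> W z -> ~ W p -> ~ W q ->
  exists K M, [/\ [/\ closed K, connected K & K p], [/\ closed M, connected M & M q],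
    C `\` W = K `|` M, forall y, K y -> M y -> False &
    K `&` closure W !=set0 /\ M `&` closure W !=set0].
Proof.
move=> [Cc Cconn Cp Cq Cmin] [oW _ [r [s [rs bW]]]] Cz Wz nWp nWq.
have CWc : closed (C `\` W) by apply: closedI => //; exact: open_closedC.
apply: contrapT => H.
suff CWconn : connected (C `\` W).
  have E : C `\` W = C by apply: Cmin => // y [].
  by have [] : (C `\` W) z by rewrite E.
apply: connected_closed_partition => // A B Ac Bc CW AB A0 B0; apply: H.
have meet P Q : closed P -> closed Q -> C `\` W = P `|` Q ->
    (forall y, P y -> Q y -> False) -> Q !=set0 -> exists2 y, Q y & (y = r \/ y = s).
  move=> Pc Qc CW' PQ Q0.
  have [y Qy] := dangling_meets_boundary Cconn oW Cz Wz Pc Qc CW' PQ Q0.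
  by rewrite bW => yrs; exists y.
have conn P Q : closed P -> closed Q -> C `\` W = P `|` Q ->
    (forall y, P y -> Q y -> False) -> P !=set0 -> connected Q.
  move=> Pc Qc CW' PQ P0; apply: connected_closed_partition => // D E Dc Ec QE DE D0 E0.
  have [|y Qy Py||u Pu urs] := meet Q P Qc Pc; first by rewrite setUC.
  - exact: (PQ y).
  - by [].
  have [|y [Py Dy|Ey Dy]||v Dv vrs] := meet (P `|` E) D (closedU Pc Ec) Dc.
  - by rewrite CW' QE setUAC setUA.
  - by apply: (PQ y) => //; rewrite QE; left.
  - exact: (DE y).
  - by [].
  have [|y [Py Ey|Dy Ey]||w Ew wrs] := meet (P `|` D) E (closedU Pc Dc) Ec.
  - by rewrite CW' QE setUA.
  - by apply: (PQ y) => //; rewrite QE; right.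
  - exact: (DE y).
  - by [].
  have uv : u <> v by move=> uv; apply: (PQ u) => //; rewrite QE uv; left.
  have uw : u <> w by move=> uw; apply: (PQ u) => //; rewrite QE uw; right.
  have vw : v <> w by move=> vw; apply: (DE v) => //; rewrite vw.
  by case: urs vrs wrs uv uw vw => -> [] -> [] -> ; tauto.
have CW' : C `\` W = B `|` A by rewrite setUC.
have AB' y : B y -> A y -> False by move=> By Ay; exact: (AB y).
have Aconn := conn B A Bc Ac CW' AB' B0.
have Bconn := conn A B Ac Bc CW AB A0.
have not_both P : P `<=` C `\` W -> closed P -> connected P -> P p -> P q -> False.
  move=> PC Pc Pconn Pp Pq.
  have PE : P = C by apply: Cmin => // y /PC [].
  by have : P z by [rewrite PE]; move=> /PC [].
have touch Q P : closed P -> closed Q -> C `\` W = P `|` Q ->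
    (forall y, P y -> Q y -> False) -> Q !=set0 -> Q `&` closure W !=set0.
  move=> Pc Qc E PQ Q0; have [y Qy yrs] := meet P Q Pc Qc E PQ Q0.
  by exists y; split => //; apply: boundary_closure; rewrite bW.
have At := touch A B Bc Ac CW' AB' A0.
have Bt := touch B A Ac Bc CW AB B0.
have : (C `\` W) p by []. have : (C `\` W) q by [].
rewrite {1 2}CW => -[Aq|Bq] -[Ap|Bp].
- by exfalso; apply: (not_both A) => //; rewrite CW => y; left.
- by exists B, A.
- by exists A, B.
- by exfalso; apply: (not_both B) => //; rewrite CW => y; right.
Qed.

(** Otherwise some two-sided neighborhood W of a point of C, with closure in V,
    has a point w of its closure off C. The trace of C on the closure of W is
    covered by an open set off w whose boundary, by [irreducible_boundary],
    lies in C; so this open set is clopen in the closure of W, which is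
    connected. *)
Lemma irreducible_open C p q V : irreducible C p q -> open V -> ~ V p -> ~ V q ->
  (forall z, V z -> order_two z) -> open (C `&` V).
Proof.
move=> Cirr oV nVp nVq V2; have [Cc Cconn _ _ _] := Cirr.
rewrite openE => z [Cz Vz].
have [W [[oW Wconn _] Wz WV]] := order_two_base (V2 z Vz) (open_nbhs_nbhs (conj oV Vz)).
suff WC : closure W `<=` C.
  apply: filterS (open_nbhs_nbhs (conj oW Wz)) => y /subset_closure Wy.
  by split; [exact: WC|exact: WV].
move=> w Ww; apply: contrapT => nCw.
have [U [oU CU nUw bU]] : exists U, [/\ open U, C `&` closure W `<=` U, ~ U w &
    boundary U `<=` C].
  apply: (@compact_ind _ (C `&` closure W) (fun B => exists U,
    [/\ open U, B `<=` U, ~ U w & boundary U `<=` C])).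
  - by apply: (subclosed_compact _ cT) => //; apply: closedI => //; exact: closed_closure.
  - exists set0; split => //; first exact: open0.
    by move=> y []; rewrite closure0.
  - by move=> B B' BB' [U [oU BU nU bU]]; exists U; split => //; exact: subset_trans BU.
  - move=> B B' [U [oU BU nU bU]] [U' [oU' BU' nU' bU']].
    exists (U `|` U'); split.
    + exact: openU.
    + by move=> y [/BU|/BU']; [left|right].
    + by case.
    + by move=> y /(boundaryU oU oU') [[/bU]|[/bU']].
  - move=> u [Cu Wu]; have Vu := WV u Wu.
    have uN : nbhs u (V `\ w).
      apply: open_nbhs_nbhs; split; last by split => // uw; apply: nCw; rewrite -uw.
      rewrite setDE; apply: openI => //; apply: closed_openC.
      exact: (compact_closed hT (@compact_set1 _ w)).
    have [W' [[oW' _ [r [s [rs bW']]]] W'u W'V]] := order_two_base (V2 u Vu) uN.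
    exists W'; first exact: open_nbhs_nbhs.
    exists W'; split => //.
      by move=> /subset_closure /W'V [_]; apply.
    have nW' v : ~ V v -> ~ W' v by move=> nVv /subset_closure /W'V [].
    have := irreducible_boundary Cirr oW' Cu W'u (nW' _ nVp) (nW' _ nVq).
    rewrite bW' => nb y yrs; apply: contrapT => nCy; apply: nb; apply/card_le1P.
    by move=> a b [Ca ars] [Cb brs]; case: yrs ars brs => yE [aE|aE] [bE|bE];
      try (by rewrite aE bE); exfalso; apply: nCy; rewrite yE -?aE -?bE.
have [||y [Wy bUy]] := connected_meets_boundary oU Wconn.
- by exists z; split; [exact: subset_closure|apply: CU; split => //; exact: subset_closure].
- by move=> /(_ w Ww).
by apply: (boundary_notin oU bUy); apply: CU; split => //; exact: bU.
Qed.

(** The point to prove is that C, irreducible between the boundary points p and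
    q of a small two-sided neighborhood V of x, contains x. If not, the closure
    of V minus C is connected and contains p and q as well, so that a small
    two-sided neighborhood W of p has one boundary point in C and the other
    one off C, both in V. Then q is the only boundary point of the union of V
    and W, against the order of x. *)
Lemma order_two_irreducible x U : open U -> U x ->
  (forall z, U z -> order_two z) ->
  exists C p q V, [/\ irreducible C p q, open V, V x, V `<=` C `&` U & ~ V p /\ ~ V q].
Proof.
move=> oU Ux U2; have [N [oN Nx] NP] := order_two_isolates (U2 x Ux).
have xNU : nbhs x (N `&` U) by apply: open_nbhs_nbhs; split => //; exact: openI.
have [V [[oV Vconn [p [q [pq bV]]]] Vx VNU]] := order_two_base (U2 x Ux) xNU.
have clVE y : closure V y -> V y \/ y = p \/ y = q.
  by move=> /closure_sub_boundary; rewrite bV.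
have [bp bq] : boundary V p /\ boundary V q by rewrite bV; split; [left|right].
have nVp := boundary_notin oV bp; have nVq := boundary_notin oV bq.
have [C [[CV Cc Cconn] Cp Cq Cmin]] := irreducible_continuum hT cT
  (closed_closure (A := V)) Vconn (boundary_closure bp) (boundary_closure bq).
have Cirr : irreducible C p q by [].
have V2 z : V z -> order_two z by move=> /subset_closure /VNU [_ /U2].
have oCV := irreducible_open Cirr oV nVp nVq V2.
exists C, p, q, (C `&` V); split => //; last 2 first.
- by move=> y [Cy /subset_closure /VNU []].
- by split => -[].
split => //; apply: contrapT => nCx.
have oVC : open (V `\` C) by apply: openI => //; exact: closed_openC.
have bVC : boundary (V `\` C) `<=` [set p; q].
  move=> y by_; have cy := boundary_closure by_.
  have : closure V y by apply: closureS cy => ? [].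
  move=> /clVE [Vy|//]; exfalso.
  have [Cy|nCy] := pselect (C y); last by apply: (boundary_notin oVC by_).
  by have [u [[_ nCu] [Cu _]]] := cy _ (open_nbhs_nbhs (conj oCV (conj Cy Vy))).
have [||DC bDp bDq] := isolates_connected_closure NP oVC _ _ bVC.
- by [].
- by move=> y [/subset_closure /VNU []].
have [_ Up] := VNU _ (boundary_closure bp).
have pN : nbhs p (N `\ q).
  apply: open_nbhs_nbhs; split; last by split => //; case: (VNU _ (boundary_closure bp)).
  rewrite setDE; apply: openI => //; apply: closed_openC.
  exact: (compact_closed hT (@compact_set1 _ q)).
have [W [[oW _ [r [s [rs bW]]]] Wp WN]] := order_two_base (U2 p Up) pN.
have nWq : ~ closure W q by move=> /WN [_]; apply.
have off y : boundary W y -> y <> p /\ y <> q.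
  move=> by_; split=> yE; last by apply: nWq; rewrite -yE; exact: boundary_closure.
  by apply: (boundary_notin oW by_); rewrite yE.
have [||y1 [Cy1 by1]] := connected_meets_boundary oW Cconn.
- by exists p.
- by move=> /(_ q Cq) /subset_closure.
have [||y2 [Dy2 by2]] := connected_meets_boundary oW DC.
- by exists p; split => //; exact: boundary_closure.
- by move=> /(_ q (boundary_closure bDq)) /subset_closure.
have Vy1 : V y1 by have [? ?] := off _ by1; have [//|[]] := clVE _ (CV _ Cy1).
have [Vy2 nCy2] : (V `\` C) y2.
  have [? ?] := off _ by2.
  by have [//|/bVC []] := closure_sub_boundary Dy2.
have bWV : boundary W `<=` V.
  have y12 : y1 <> y2 by move=> y12; apply: nCy2; rewrite -y12.
  move: by1 by2; rewrite bW => y1rs y2rs y yrs.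
  by case: y1rs => E1; case: y2rs => E2; case: yrs => ->;
    first [by case: y12; rewrite E1 E2|by rewrite -E1|by rewrite -E2].
apply: (NP (V `|` W)); first exact: openU; first by left.
  by move=> y [/subset_closure /VNU []|/subset_closure /WN []].
apply/card_le1P; suff H y : boundary (V `|` W) y -> y = q by move=> y z /H -> /H ->.
move=> /(boundaryU oV oW) [[]|[/bWV //]].
by rewrite bV => -[->|].
Qed.

End order_two_structure.

(** * Parametrizing an irreducible continuum *)

Section weighted_sup.
Context {R : realType}.
Implicit Types u v : nat -> R.

Definition wsum u N : R := \sum_(n < N) u n / 2 ^+ n.+1.

(** The sum of the series of general term u n / 2 ^+ n.+1, when the values of u
    lie in [0, 1]. *)
Definition wsup u : R := sup (range (wsum u)).

Lemma wsum_const (e : R) N : \sum_(n < N) e / 2 ^+ n.+1 = e * (1 - 2 ^- N).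
Proof.
elim: N => [|N IH]; first by rewrite big_ord0 expr0 invr1 subrr mulr0.
rewrite big_ord_recr /= IH exprS invfM.
have -> : (2 ^- N : R) = 2 * (2^-1 * 2 ^- N) by rewrite mulrA divff ?mul1r.
by lra.
Qed.

Lemma wsum_leD u v e N : 0 <= e -> (forall n, u n <= v n + e) ->
  wsum u N <= wsum v N + e.
Proof.
move=> e0 uv; apply: (@le_trans _ _ (wsum v N + e * (1 - 2 ^- N))).
  rewrite -wsum_const -big_split /=; apply: ler_sum => n _.
  by rewrite -mulrDl ler_pM2r // invr_gt0 exprn_gt0.
by rewrite lerD2l ler_piMr // gerBl invr_ge0 exprn_ge0.
Qed.

Lemma has_sup_wsum u : (forall n, u n <= 1) -> has_sup (range (wsum u)).
Proof.
move=> u1; split; first by exists (wsum u 0%N), 0%N.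
exists 1 => _ [N _ <-]; have := @wsum_leD u (fun=> 0) 1 N ler01.
rewrite {2}/wsum big1 ?add0r; last by move=> n _; rewrite mul0r.
by apply.
Qed.

(** The weights add up to 1, so that a uniform error is not amplified. *)
Lemma wsup_leD u v e : (forall n, v n <= 1) -> 0 <= e ->
  (forall n, u n <= v n + e) -> wsup u <= wsup v + e.
Proof.
move=> v1 e0 uv; apply: sup_le_ub; first by exists (wsum u 0%N), 0%N.
move=> _ [N _ <-]; apply: le_trans (wsum_leD N e0 uv) _; rewrite lerD2r.
by apply: sup_upper_bound; [exact: has_sup_wsum|exists N].
Qed.

Lemma wsup_lt u v k : (forall n, v n <= 1) -> (forall n, 0 <= u n <= v n) ->
  u k < v k -> wsup u < wsup v.
Proof.
move=> v1 uv uvk; pose c := (v k - u k) / 2 ^+ k.+1.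
have c0 : 0 < c by rewrite divr_gt0 ?subr_gt0 ?exprn_gt0.
have mono N M : (N <= M)%N -> wsum u N <= wsum u M.
  move=> /subnK <-; elim: (M - N)%N => // m IH; apply: (le_trans IH).
  rewrite addSn /wsum big_ord_recr /= lerDl divr_ge0 ?exprn_ge0 //.
  by case/andP: (uv (m + N)%N).
have step N : (k < N)%N -> wsum u N + c <= wsum v N.
  move=> kN; rewrite /wsum (bigD1 (Ordinal kN)) //= [leRHS](bigD1 (Ordinal kN)) //=.
  rewrite addrAC /c -mulrDl [u k + _]addrC subrK lerD2l; apply: ler_sum => n _.
  by rewrite ler_pM2r ?invr_gt0 ?exprn_gt0 //; case/andP: (uv n).
suff : wsup u + c <= wsup v by apply: lt_le_trans; rewrite ltrDl.
rewrite -lerBrDr; apply: sup_le_ub; first by exists (wsum u 0%N), 0%N.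
move=> _ [N _ <-]; rewrite lerBrDr.
apply: (@le_trans _ _ (wsum u (maxn N k.+1) + c)).
  by rewrite lerD2r; apply: mono; exact: leq_maxl.
apply: le_trans (step _ (leq_maxr _ _)) _.
by apply: sup_upper_bound; [exact: has_sup_wsum|exists (maxn N k.+1)].
Qed.

End weighted_sup.

Section parametrization.
Context {R : realType} {T : topologicalType}.
Hypotheses (hT : hausdorff_space T) (cT : compact [set: T]).
Hypothesis connT : connected [set: T].
Context {d : T -> T -> R} (dT : metrized d).
Context {C V : set T} {p q : T}.
Hypotheses (Cirr : irreducible C p q) (oV : open V) (VC : V `<=` C).
Hypotheses (nVp : ~ V p) (nVq : ~ V q).
Hypothesis V2 : forall z, V z -> order_two z.

Definition subcontinua (y : T) : set (set T) :=
  [set K | [/\ K `<=` C, closed K, connected K, K p & K y]].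

(** Once C is known to be an arc from p to q, this is its subarc from p to y. *)
Definition initial_part (y : T) : set T := \bigcap_(K in subcontinua y) K.

Let I := initial_part.

Lemma initial_part_self y : I y y.
Proof. by move=> K []. Qed.

Lemma closed_initial_part y : closed (I y).
Proof. by apply: closed_bigI => K []. Qed.

(** Adding the closure of a small connected neighborhood of y to a subcontinuum
    through p and one of its points gives one through p and any other. *)
Lemma initial_part_near y N : V y -> nbhs y N -> exists W, [/\ open W, W y,
  W `<=` N & forall y', W y' -> I y' `<=` I y `|` N /\ I y `<=` I y' `|` N].
Proof.
move=> Vy yN.
have yNV : nbhs y (N `&` V) by apply: filterI => //; exact: open_nbhs_nbhs.
have [W [[oW Wconn _] Wy WNV]] := order_two_base hT cT connT (V2 Vy) yNV.
exists W; split => //; first by move=> z /subset_closure /WNV [].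
have half u v : W u -> W v -> I u `<=` I v `|` N.
  move=> Wu Wv z Iz; have [Wz|nWz] := pselect (closure W z).
    by right; case: (WNV _ Wz).
  left=> K [KC Kc Kconn Kp Kv].
  have : (K `|` closure W) z; last by case.
  apply: Iz; split.
  - by move=> t [/KC//|/WNV [_ /VC]].
  - by apply: closedU => //; exact: closed_closure.
  - by apply: connectedU => //; exists v; split => //; exact: subset_closure.
  - by left.
  - by right; exact: subset_closure.
by move=> y' Wy'; split; exact: half.
Qed.

(** Cut C at y into a part K with p and a part M with q. If y' lies in K, then
    K is a subcontinuum through p and y' without y, and every subcontinuum
    through p and y contains y', as otherwise adding M to it would contradict
    irreducibility. If y' lies in M, the roles of y and y' are exchanged. *)
Lemma initial_part_lt y y' : V y -> V y' -> y <> y' ->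
  (I y' `<=` I y /\ ~ I y' y) \/ (I y `<=` I y' /\ ~ I y y').
Proof.
move=> Vy Vy' yy'; have [Cc Cconn Cp Cq Cmin] := Cirr.
have yN : nbhs y (V `\ y').
  apply: open_nbhs_nbhs; split => //; rewrite setDE; apply: openI => //.
  by apply: closed_openC; exact: (compact_closed hT (@compact_set1 _ y')).
have [W [W2 Wy WV]] := order_two_base hT cT connT (V2 Vy) yN.
have [oW Wconn _] := W2.
have nW z : ~ V z -> ~ W z by move=> nVz /subset_closure /WV [].
have [K [M [[Kc Kconn Kp] [Mc Mconn Mq] CW KM [KW MW]]]] :=
  irreducible_cut Cirr W2 (VC Vy) Wy (nW _ nVp) (nW _ nVq).
have nWy' : ~ closure W y' by move=> /WV [_]; apply.
have KMC z : K z \/ M z -> C z /\ ~ W z.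
  by move=> KMz; have : (K `|` M) z by []; rewrite -CW => -[].
have WC : closure W `<=` C by move=> z /WV [/VC].
have : (C `\` W) y' by split; [exact: VC|move=> /subset_closure].
rewrite CW => -[Ky'|My'].
  have IK : I y' `<=` K by move=> t; apply; split => // z Kz; case: (KMC z); first by left.
  have nIy : ~ I y' y by move=> /IK Ky; case: (KMC y); first by left.
  left; split => // u Iu K' [K'C K'c K'conn K'p K'y]; apply: Iu; split => //.
  apply: contrapT => nK'y'.
  have E : K' `|` (closure W `|` M) = C.
    apply: Cmin.
    - by move=> z [/K'C//|[/WC//|Mz]]; case: (KMC z); first by right.
    - by apply: closedU => //; apply: closedU => //; exact: closed_closure.
    - apply: connectedU => //.
        by exists y; split => //; left; exact: subset_closure.
      by apply: connectedU => //; rewrite setIC.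
    - by left.
    - by right; right.
  have : C y' by exact: VC.
  by rewrite -E => -[//|[//|My']]; exact: (KM y').
right; split.
  move=> u Iu K' [K'C K'c K'conn K'p K'y']; apply: Iu; split => //.
  apply: contrapT => nK'y.
  have E : K' `|` M = C.
    apply: Cmin.
    - by move=> z [/K'C//|Mz]; case: (KMC z); first by right.
    - exact: closedU.
    - by apply: connectedU => //; exists y'.
    - by left.
    - by right.
  have : C y by exact: VC.
  by rewrite -E => -[//|My]; case: (KMC y); first by right.
move=> /(_ (K `|` closure W)) [|Ky'|//].
  split.
  - by move=> z [Kz|/WC//]; case: (KMC z); first by left.
  - by apply: closedU => //; exact: closed_closure.
  - exact: connectedU.
  - by left.
  - by right; exact: subset_closure.
exact: (KM y').
Qed.

Definition dist_initial (z y : T) : R := inf [set d z u | u in I y].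

Lemma has_inf_dist z y : has_inf [set d z u | u in I y].
Proof.
split; first by exists (d z y); exists y => //; exact: initial_part_self.
by exists 0 => _ [u _ <-]; exact: (met_ge0 dT).
Qed.

Lemma dist_initial_le z y u : I y u -> dist_initial z y <= d z u.
Proof. by move=> Iu; apply: inf_lbound; [case: (has_inf_dist z y)|exists u]. Qed.

Lemma dist_initial_ge z y c : (forall u, I y u -> c <= d z u) -> c <= dist_initial z y.
Proof.
move=> H; apply: lb_le_inf; first by case: (has_inf_dist z y).
by move=> _ [u Iu <-]; exact: H.
Qed.

(** The distance of the n-th point of a dense sequence to I(y) decreases as I(y)
    grows, and strictly so for some n: take a point of the sequence near y,
    where y is at positive distance from the smaller set. The weighted sum over
    n is continuous, since by [initial_part_near] all these distances vary by
    little at once. *)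
Lemma irreducible_parametrization : exists h : T -> R,
  (forall y N, V y -> nbhs (h y) N -> nbhs y (h @^-1` N)) /\
  (forall y y', V y -> V y' -> h y = h y' -> y = y').
Proof.
have [z zP] := compact_metrized_separable dT cT p.
(* truncated at 1 to be summable, reversed to increase along C *)
pose a y n := 1 - Num.min 1 (dist_initial (z n) y).
pose h y := wsup (a y).
have a01 y n : 0 <= a y n <= 1.
  have D0 : 0 <= dist_initial (z n) y.
    by apply: dist_initial_ge => u _; exact: (met_ge0 dT).
  rewrite subr_ge0 ge_min lexx /= gerBl le_min ler01 D0 //.
have hlt y y' : I y' `<=` I y -> ~ I y' y -> h y' < h y.
  move=> Iyy' nI; have [e e0 eI] : exists2 e : R, 0 < e & forall u, d y u < e -> ~ I y' u.
    apply/(met_nbhs dT y (~` I y')).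
    by apply: open_nbhs_nbhs; split => //; apply: closed_openC; exact: closed_initial_part.
  pose r := Num.min 1 (e / 2).
  have r0 : 0 < r by rewrite lt_min ltr01 divr_gt0.
  have r1 : r <= 1 by rewrite ge_min lexx.
  have re : r <= e / 2 by rewrite ge_min lexx orbT.
  have [n zn] := zP y r r0.
  apply: (@wsup_lt _ _ _ n) => [k|k|].
  - by case/andP: (a01 y k).
  - case/andP: (a01 y' k) => -> _ /=; rewrite lerD2l lerN2 le_min ge_min lexx /=.
    rewrite ge_min; apply/orP; right; apply: dist_initial_ge => u /Iyy'.
    exact: dist_initial_le.
  - rewrite ltrD2l ltrN2 lt_min; apply/andP; split.
      rewrite gt_min; apply/orP; right; apply: le_lt_trans (lt_le_trans zn r1).
      exact: (@dist_initial_le (z n) y y (@initial_part_self y)).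
    rewrite gt_min; apply/orP; right.
    apply: (@lt_le_trans _ _ r).
      by apply: le_lt_trans zn; exact: (@dist_initial_le (z n) y y (@initial_part_self y)).
    apply: dist_initial_ge => u Iu; rewrite leNgt; apply/negP => ur.
    apply: (eI u) => //; apply: le_lt_trans (met_tri dT y (z n) u) _.
    by rewrite (met_sym dT y); lra.
exists h; split=> [y N Vy|y y' Vy Vy' hyy'].
  move=> /nbhs_ballP [e /= e0 eN].
  pose e4 := e / 4.
  have e40 : 0 < e4 by rewrite divr_gt0.
  have [W [oW Wy WN WI]] := initial_part_near Vy (nbhs_met dT y e40).
  have close u v : W u -> W v -> (forall t, I v t -> I u t \/ d y t < e4) ->
      forall n, dist_initial (z n) u <= dist_initial (z n) v + 2 * e4.
    move=> Wu Wv Ivu n; rewrite -lerBlDr; apply: dist_initial_ge => t /Ivu [Iut|yt].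
      rewrite lerBlDr (le_trans (@dist_initial_le (z n) u t Iut)) // lerDl mulr_ge0 //.
      exact: ltW.
    have := @dist_initial_le (z n) u u (@initial_part_self u).
    have := met_tri dT (z n) t u; have := met_tri dT t y u.
    have : d y u < e4 := WN u Wu.
    rewrite (met_sym dT t y) => H1 H2 H3 H4; lra.
  have hclose u v : W u -> W v -> (forall t, I v t -> I u t \/ d y t < e4) ->
      h v <= h u + 2 * e4.
    move=> Wu Wv Ivu; apply: wsup_leD => [n||n].
    - by case/andP: (a01 u n).
    - by rewrite mulr_ge0 // ltW.
    - have := close u v Wu Wv Ivu n; rewrite /a.
      by rewrite /Num.min; do 2! case: ifP; lra.
  apply: filterS (open_nbhs_nbhs (conj oW Wy)) => u Wu; apply: eN.
  have [Iu Iy] := WI u Wu.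
  have H1 := hclose y u Wy Wu (fun t It => Iu t It).
  have H2 := hclose u y Wu Wy (fun t It => Iy t It).
  rewrite /ball /= ltr_distl; move: H1 H2; rewrite /e4 => H1 H2.
  by apply/andP; split; lra.
apply: contrapT => nyy'.
by case: (initial_part_lt Vy Vy' nyy') => -[H1 H2]; have := hlt _ _ H1 H2; rewrite hyy' ltxx.
Qed.

End parametrization.

(** * Free arcs around points of order two *)

Section free_arc_at.
Context {R : realType} {T : topologicalType}.
Hypothesis hT : hausdorff_space T.

(** If h were minimal at x, then a sublevel set of h slightly above h x would
    stay away from the boundary of W, and injectivity would leave it with a
    single boundary point. *)
Lemma isolates_not_minimum (N W : set T) (x r s : T) (h : T -> R) :
  isolates N x -> open W -> W x -> W `<=` N -> boundary W = [set r; s] ->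
  (forall y M, closure W y -> nbhs (h y) M -> nbhs y [set z | closure W z -> M (h z)]) ->
  (forall y z, closure W y -> closure W z -> h y = h z -> y = z) ->
  exists2 y, closure W y & h y < h x.
Proof.
move=> Nx oW Wx WN bW hc hinj; apply: contrapT => nmin.
have hmin y : closure W y -> h x <= h y.
  by move=> Wy; rewrite leNgt; apply/negP => yx; apply: nmin; exists y.
have clx := subset_closure Wx.
have br : boundary W r by rewrite bW; left.
have bs : boundary W s by rewrite bW; right.
have above y : boundary W y -> h x < h y.
  move=> by_; rewrite lt_neqAle hmin ?andbT; last exact: boundary_closure.
  apply/eqP => /hinj xy; apply: (boundary_notin oW by_).
  by rewrite -xy //; exact: boundary_closure.
have [b [xb br' bs']] : exists b, [/\ h x < b, b < h r & b < h s].
  have hrs : h x < Num.min (h r) (h s) by rewrite lt_min !above.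
  exists ((h x + Num.min (h r) (h s)) / 2).
  have : (h x + Num.min (h r) (h s)) / 2 < Num.min (h r) (h s) by rewrite midf_lt.
  by rewrite lt_min => /andP[? ?]; split => //; rewrite midf_lt.
pose V := W `&` [set y | h y < b].
have oV : open V.
  rewrite openE => y [Wy /= yb]; have clWy := subset_closure Wy.
  have yM : nbhs (h y) [set t | t < b] by exact: lt_nbhsl.
  apply: filterS2 (open_nbhs_nbhs (conj oW Wy)) (hc y _ clWy yM) => z Wz zb.
  by split => //; apply: zb; exact: subset_closure.
apply: (Nx V oV) => //; first by move=> y [/WN].
have bV y : boundary V y -> closure W y /\ h y = b.
  move=> by_; have cy := boundary_closure by_.
  have Wy : closure W y by apply: closureS cy => ? [].
  split => //; apply/eqP; rewrite eq_le !leNgt; apply/andP; split; apply/negP => yb.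
    have yM : nbhs (h y) [set t | b < t] by exact: lt_nbhsr.
    have [z [[Wz /= zb] bz]] := cy _ (hc y _ Wy yM).
    by have := lt_trans (bz (subset_closure Wz)) zb; rewrite ltxx.
  have [Wy'|] := closure_sub_boundary Wy; first by apply: (boundary_notin oV by_).
  by rewrite bW => -[yE|yE]; move: yb; rewrite yE => /lt_trans /(_ _);
    [move=> /(_ _ br')|move=> /(_ _ bs')]; rewrite ltxx.
by apply/card_le1P => y z /bV [Wy yb] /bV [Wz zb]; apply: hinj; rewrite ?yb ?zb.
Qed.

Lemma bound_avoiding (y t c c' : R) : y < t -> c <> t -> c' <> t ->
  exists a, [/\ y <= a, a < t, ~ a < c < t & ~ a < c' < t].
Proof.
move=> yt ct c't; pose low z := if z < t then z else y.
have low_lt z : low z < t by rewrite /low; case: ifP.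
have lowP z a : low z <= a -> ~ a < z < t.
  by rewrite /low; case: ifP => zt la /andP[az //]; rewrite leNgt az in la.
exists (Num.max y (Num.max (low c) (low c'))); split.
- by rewrite le_max lexx.
- by rewrite !gt_max yt !low_lt.
- by apply: lowP; rewrite !le_max lexx orbT.
- by apply: lowP; rewrite !le_max lexx !orbT.
Qed.

Hypotheses (cT : compact [set: T]) (connT : connected [set: T]).
Context {d : T -> T -> R} (dT : metrized d).

(** The function h of [irreducible_parametrization] maps the closure of a small
    two-sided neighborhood W of x homeomorphically onto an interval with h x
    inside. A segment [a, b] around h x that has neither h r nor h s between
    its ends, where r and s are the boundary points of W, parametrizes an arc
    with inner part in W. *)
Lemma order_two_free_arc (U : set T) x : open U -> U x ->
  (forall z, U z -> order_two z) ->
  exists A, free_arc R A /\ arc_interior R A x.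
Proof.
move=> oU Ux U2.
have [C [p [q [V [Cirr oV Vx VCU [nVp nVq]]]]]] :=
  order_two_irreducible hT cT connT oU Ux U2.
have VC : V `<=` C by move=> y /VCU [].
have V2 y : V y -> order_two y by move=> /VCU [_ /U2].
have [h [hc hinj]] := irreducible_parametrization hT cT connT dT Cirr oV VC nVp nVq V2.
have [N [oN Nx] NP] := order_two_isolates (U2 x Ux).
have xNV : nbhs x (N `&` V) by apply: open_nbhs_nbhs; split => //; exact: openI.
have [W [[oW Wconn [r [s [rs bW]]]] Wx WNV]] := order_two_base hT cT connT (U2 x Ux) xNV.
have WV : closure W `<=` V by move=> y /WNV [].
have WN : W `<=` N by move=> y /subset_closure /WNV [].
have clWx := subset_closure Wx.
have hcont : {within closure W, continuous h}.
  apply/subspace_continuousP => y Wy M yM.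
  by apply: filterS (hc y M (WV y Wy) yM) => z Mz _.
have hcW y M : closure W y -> nbhs (h y) M -> nbhs y [set z | closure W z -> M (h z)].
  by move=> Wy yM; apply: filterS (hc y M (WV y Wy) yM) => z Mz _.
have hinjW y z : closure W y -> closure W z -> h y = h z -> y = z.
  by move=> /WV Vy /WV Vz; exact: hinj.
have [y1 Wy1 y1x] := isolates_not_minimum NP oW Wx WN bW hcW hinjW.
have [y2 Wy2 y2x] : exists2 y, closure W y & - h y < - h x.
  apply: (isolates_not_minimum (h := fun y => - h y) NP oW Wx WN bW).
    move=> y M Wy yM; have : nbhs (h y) [set t | M (- t)].
      exact: (@opp_continuous R^o (h y) M yM).
    exact: hcW.
  by move=> y z Wy Wz /oppr_inj; exact: hinjW.
rewrite ltrN2 in y2x.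
have Rhaus : hausdorff_space R by exact: norm_hausdorff.
have [g hg] : exists g, homeomorphism (closure W) (h @` closure W) h g.
  apply: homeomorphism_of_injective => //.
  - by apply: (subclosed_compact _ cT) => //; exact: closed_closure.
  - by exists x.
  - by move=> y z /set_mem Wy /set_mem Wz; exact: hinjW.
have gh := homeo_sym hg.
have /connected_intervalP Jint := connected_continuous_connected Wconn hcont.
have ne y : boundary W y -> h y <> h x.
  move=> by_ /hinjW yx; apply: (boundary_notin oW by_).
  by rewrite yx //; exact: boundary_closure.
have [hr hs] : h r <> h x /\ h s <> h x.
  by split; apply: ne; rewrite bW; [left|right].
have [a [y1a ax ar as_]] := bound_avoiding y1x hr hs.
have [b' [y2b bx br bs]] : exists b', [/\ - h y2 <= b', b' < - h x,
    ~ b' < - h r < - h x & ~ b' < - h s < - h x].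
  by apply: bound_avoiding; rewrite ?ltrN2 // => /oppr_inj.
pose b := - b'.
have xb : h x < b by rewrite /b ltrNr.
have by2 : b <= h y2 by rewrite /b lerNl.
have ab : a < b by exact: lt_trans xb.
have abJ : `[a, b] `<=` h @` closure W.
  move=> t; rewrite /= in_itv /= => /andP[at_ tb].
  apply: (Jint (h y1) (h y2)); [by exists y1|by exists y2|].
  by rewrite (le_trans y1a at_) (le_trans tb by2).
have avoid y : boundary W y -> ~ a < h y < b.
  move=> by_ /andP[ay yb]; case: (ltgtP (h y) (h x)) => [yx|xy|]; last exact: ne.
    by move: by_ ay yx; rewrite bW => -[->|->] ay yx; [apply: ar|apply: as_]; rewrite ay.
  have b'y : b' < - h y by rewrite ltrNr.
  have yx : - h y < - h x by rewrite ltrN2.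
  by move: by_ b'y yx; rewrite bW => -[->|->] b'y yx; [apply: br|apply: bs]; rewrite b'y.
have gW : g @` `]a, b[ `<=` W.
  move=> _ [t tab <-].
  have tc : `[a, b]%classic t by exact: subset_itv_oo_cc tab.
  have Wgt := homeo_sub gh (abJ t tc); have hgt := homeo_can gh (abJ t tc).
  have [//|bgt] := closure_sub_boundary Wgt; exfalso.
  by apply: (avoid _ bgt); rewrite hgt; move: tab; rewrite /= in_itv.
have [free int] := free_subarc hT gh oW (@subset_closure _ W) ab abJ gW.
exists (g @` `[a, b]); split; rewrite // int; exists (h x).
  by rewrite /= in_itv /= ax xb.
exact: (homeo_can hg).
Qed.

End free_arc_at.

(** Off the closed countable set K of the definition every point has order two,
    unless the space is a single point. *)
Lemma tame_graph_free_arc_cover (R : realType) (G : topologicalType) :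
  tame_graph R G -> exists (F : set (set G)) (C : set G),
    [/\ countable F, (forall a, F a -> free_arc R a), countable C &
        [set: G] = (\bigcup_(a in F) a) `|` C].
Proof.
move=> [[[x0 _] cG connG /metrizable_setTP [d dG]] cK].
have hG := metrized_hausdorff dG.
pose K := closure (@endpoints G `|` @branchpoints G).
have [[y xy]|single] := pselect (exists y, x0 <> y); last first.
  exists set0, [set: G]; split => //; last by rewrite bigcup_set0 set0U.
  rewrite (_ : [set: G] = [set x0]); first exact: countable1.
  apply/seteqP; split => // y _ /=; apply: contrapT => xy.
  by apply: single; exists y => /esym.
have oU : open (~` K) by apply: closed_openC; exact: closed_closure.
have U2 z : (~` K) z -> order_two z.
  move=> nKz.
  have [u zu] : exists u, z <> u.
    have [zx|zx] := pselect (z = x0); first by exists y; rewrite zx.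
    by exists x0.
  apply: (not_end_not_branch_order_two hG connG zu) => ez; apply: nKz;
    apply: subset_closure; first [by left|by right].
have [F [cF FQ KF]] : exists F : set (set G),
    [/\ countable F, F `<=` [set A | free_arc R A] & ~` K `<=` \bigcup_(A in F) A].
  apply: (compact_metrized_lindelof dG cG) => x Ux.
  have [A [freeA Ax]] := order_two_free_arc (R := R) hG cG connG dG oU Ux U2.
  exists A => //; have [_ oA] := freeA.
  by apply: filterS (open_nbhs_nbhs (conj oA Ax)) => z [].
exists F, K; split => //; apply/seteqP; split => // z _.
by have [Kz|/KF] := pselect (K z); [right|left].
Qed.

Theorem theorem1p2 (R : realType) (G : topologicalType)
    (hG : continuum R [set: G]) :
  [<-> tame_graph R G;
       exists (F : set (set G)) (C : set G),
         [/\ countable F, (forall a, F a -> free_arc R a), countable C &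
             [set: G] = (\bigcup_(a in F) a) `|` C];
       exists P : set (set G), tame_partition R P;
       countable [set x : G |
         ~ exists N : set G, nbhs x N /\ finite_graph R N]].
Proof.
have [_ cG connG mG] := hG; have [d dG] := metrizable_setTP mG.
have hausG := metrized_hausdorff dG.
tfae.
- exact: tame_graph_free_arc_cover.
- by move=> [F [C [cF freeF cC cover]]]; exact: free_arc_cover_partition cover.
- move=> [P [cP freeP _ cC]].
  apply: (@sub_countable _ _ _
    (~` (\bigcup_(a in P) a) `|` \bigcup_(a in P) arc_ends R a)); last first.
    apply: countable_setU => //; apply: bigcup_countable => // a /freeP.
    move=> [[f [g fg]] _]; rewrite (arc_endsE fg).
    exact/finite_set_countable/finite_set2.
  apply: subset_card_le => x nNx.
  have [[a Pa ax]|] := pselect ((\bigcup_(a in P) a) x); last by left.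
  right; exists a => //; apply: contrapT => nex; apply: nNx.
  exists a; split; last by apply: arc_finite_graph => //; case: (freeP a Pa).
  have [_ oa] := freeP a Pa.
  by apply: filterS (open_nbhs_nbhs (conj oa (conj ax nex))) => z [].
- by move=> bad; split => //; exact: (locally_finite_graph_tame hausG cG mG bad).
Qed.
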